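(* Let $\mu$ be a partition of the integer $k$ and $(S_1,S_2)$ a fixed couple of pair-partitions of $[2k]$ of type $\mu$, and let $G$, $\mathcal{P}^o$ be as in the context. Then, as functions on Young diagrams, $$\Sigma^{(2)}_\mu=\sum_{\Omega}(-1)^{\mathcal{L}(S_0(\Omega),S_1)}N^{(1)}_{S_0(\Omega),S_1,S_2},$$ where the sum runs over the orbits $\Omega$ of $\mathcal{P}^o$ under the diagonal action of $G$, and $S_0(\Omega)$ denotes the first component of an arbitrary element of $\Omega$.
   Context: Pair-partitions of $[2k]$ are identified with fixed-point-free involutions; $\mathfrak{S}_{2k}$ acts on them by: $\{\sigma(i),\sigma(j)\}$ is a pair of $\sigma\cdot P$ iff $\{i,j\}$ is a pair of $P$. For pair-partitions $A,B$, $\mathcal{L}(A,B)$ is the bipartite graph with a black vertex per pair of $A$, a white vertex per pair of $B$, and an edge labeled $i$ for each $i\in[2k]$ joining the pairs containing $i$; it is a union of loops of lengths $2\ell_1\ge2\ell_2\ge\cdots$, each viewed as the set of its labels; $(\ell_1,\ell_2,\dots)$ is the type; $(-1)^{\mathcal{L}(A,B)}=(-1)^{k-|\mathcal{L}(A,B)|}$ with $|\mathcal{L}(A,B)|$ the number of loops. The group $G$: for each loop $L_i$ of $\mathcal{L}(S_1,S_2)$ (of length $2\mu_i$) choose an element $j_{i,1}\in L_i$ and set $j_{i,2}=S_2(j_{i,1})$, $j_{i,3}=S_1(j_{i,2})$, $j_{i,4}=S_2(j_{i,3})$, and so on alternately up to $j_{i,2\mu_i}$ (so $S_1(j_{i,2\mu_i})=j_{i,1}$).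 Let $r_i\in\mathfrak{S}_{2k}$ send $j_{i,m}$ to $j_{i,2\mu_i+1-m}$ for $m\in[2\mu_i]$ and fix all other elements; $G$ is the group generated by the $r_i$. An orientation $\phi$ is a coloring of each element of $[2k]$ red or green; it is compatible with $\mathcal{L}(S_0,S_1)$ if each pair of $S_0$ and each pair of $S_1$ contains one red and one green element. $\mathcal{P}^o$ is the set of couples $(S_0,\phi)$ with $S_0$ a pair-partition of $[2k]$ and $\phi$ compatible with $\mathcal{L}(S_0,S_1)$. $\mathfrak{S}_{2k}$ acts on orientations: the color of $\sigma(i)$ in $\sigma\cdot\phi$ is the color of $i$ in $\phi$; $G$ acts diagonally on $\mathcal{P}^o$. $N^{(1)}_{S_0,S_1,S_2}(\lambda)$ is the number of functions $f$ from $[2k]$ to the boxes of $\lambda$ with, for all $l$: $f(l)=f(S_0(l))$; $f(l),f(S_1(l))$ in the same column; $f(l),f(S_2(l))$ in the same row. Zonal characters: $Z_\lambda=\sum_{|\rho|=|\lambda|}\theta^{(2)}_\rho(\lambda)p_\rho$ (Macdonald normalization); for $|\lambda|\ge|\mu|$, $\Sigma^{(2)}_\mu(\lambda)=\binom{|\lambda|-|\mu|+m_1(\mu)}{m_1(\mu)}z_\mu\theta^{(2)}_{\mu\cup1^{|\lambda|-|\mu|}}(\lambda)$ and $0$ otherwise. *)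

(* Defs.v *)
From HB Require Import structures.
From mathcomp Require Import all_boot all_order all_algebra all_fingroup.
From mathcomp Require Import mpoly.

Set Implicit Arguments.
Unset Strict Implicit.
Unset Printing Implicit Defensive.

Import GRing.Theory.
Local Open Scope ring_scope.

Definition is_partition (s : seq nat) : bool :=
  sorted geq s && all (fun x => 0 < x)%N s.

Definition parts (n : nat) : seq (seq nat) :=
  [seq s <- undup [seq filter (fun i => 0 < i)%N (map val (tval t))
                  | t <- enum {: n.-tuple 'I_n.+1}]
     | is_partition s & sumn s == n].

Definition zee (rho : seq nat) : nat :=
  \prod_(i <- undup rho) (i ^ count_mem i rho * (count_mem i rho)`!)%N.

Definition dominated (mu lam : seq nat) : bool :=
  [forall i : 'I_(size mu + size lam).+1,
     sumn (take i mu) <= sumn (take i lam)]%N.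

(* Symmetric functions of degree n, realised in n variables.          *)
Definition psum (n r : nat) : {mpoly rat[n]} := \sum_(i < n) 'X_i ^+ r.
Definition pprod (n : nat) (rho : seq nat) : {mpoly rat[n]} :=
  \prod_(r <- rho) psum n r.
Definition mon (n : nat) (mu : seq nat) : 'X_{1..n} :=
  [multinom (nth 0%N mu i) | i < n].

Definition Zpoly (theta : seq nat -> seq nat -> rat) (n : nat) (lam : seq nat)
  : {mpoly rat[n]} :=
  \sum_(rho <- parts n) theta rho lam *: pprod n rho.

(* theta (rho) (lambda) = theta^{(2)}_rho(lambda): Z_lambda = J^{(2)}_lambda,
   characterised (Macdonald VI.10) by triangularity in the monomial basis
   w.r.t. dominance, orthogonality for <p_rho,p_sigma> = delta z_rho 2^{l(rho)},
   and the normalisation [x_1...x_n] J_lambda = n!. *)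
Definition zonal_spec (theta : seq nat -> seq nat -> rat) : Prop :=
  forall n lam, lam \in parts n ->
  [/\ (forall mu, mu \in parts n ->
         (Zpoly theta n lam)@_(mon n mu) != 0 -> dominated mu lam),
      (forall lam', lam' \in parts n -> lam' != lam ->
         \sum_(rho <- parts n)
            theta rho lam * theta rho lam' * (zee rho)%:R * 2 ^+ size rho = 0)
    & (Zpoly theta n lam)@_(mon n (nseq n 1%N)) = (n`!)%:R].

Definition Sigma2 (theta : seq nat -> seq nat -> rat) (mu lam : seq nat) : rat :=
  if (sumn mu <= sumn lam)%N then
    ('C(sumn lam - sumn mu + count_mem 1%N mu, count_mem 1%N mu))%:R
    * (zee mu)%:R * theta (mu ++ nseq (sumn lam - sumn mu) 1%N) lam
  else 0.

Section PairPartitions.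
Variable k : nat.
Notation T := 'I_(2 * k).

Definition pair_partition (S : {perm T}) : bool :=
  [forall i, (S (S i) == i) && (S i != i)].

(* Loops of L(A,B), each viewed as its set of labels: connected components
   of the edge set, where edges i, j are adjacent iff j = A i or j = B i. *)
Definition loops (A B : {perm T}) : {set {set T}} :=
  [set [set j | connect [rel x y | (y == A x) || (y == B x)] i j] | i : T].

Definition loop_type (A B : {perm T}) : seq nat :=
  sort geq [seq (#|L| %/ 2)%N | L : {set T} <- enum (loops A B)].

Definition loop_sign (A B : {perm T}) : rat := (-1) ^+ (k - #|loops A B|).

Fixpoint jseq (S1 S2 : {perm T}) (x : T) (t : nat) : T :=
  match t with
  | 0 => x
  | t'.+1 => (if odd t' then S1 else S2) (jseq S1 S2 x t')
  end.

(* r_L : j_m |-> j_{2 mu + 1 - m} on L, identity elsewhere *)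
Definition rfun (S1 S2 : {perm T}) (start : {set T} -> T) (L : {set T}) (y : T)
  : T :=
  let s := [seq jseq S1 S2 (start L) t | t <- iota 0 #|L|] in
  if y \in L then nth y s (#|L| - (index y s).+1) else y.

Definition Ggens (S1 S2 : {perm T}) (start : {set T} -> T) : {set {perm T}} :=
  [set s : {perm T} | [exists L in loops S1 S2, [forall y, s y == rfun S1 S2 start L y]]].

Definition Ggroup (S1 S2 : {perm T}) (start : {set T} -> T) : {set {perm T}} :=
  (<< Ggens S1 S2 start >>)%g.

(* Orientations (true = red, false = green) and the set P^o *)
Definition Po := ({perm T} * {ffun T -> bool})%type.

Definition compatible (S0 S1 : {perm T}) (phi : {ffun T -> bool}) : bool :=
  [forall i, (phi (S0 i) != phi i) && (phi (S1 i) != phi i)].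

Definition Po_set (S1 : {perm T}) : {set Po} :=
  [set x : Po | pair_partition x.1 && compatible x.1 S1 x.2].

(* diagonal action: sigma.S0 = sigma S0 sigma^-1, (sigma.phi)(sigma i) = phi i *)
Definition actPo (g : {perm T}) (x : Po) : Po :=
  ((x.1 ^ g)%g, [ffun y => x.2 ((g^-1)%g y)]).

Definition orbitsPo (S1 S2 : {perm T}) (start : {set T} -> T) : {set {set Po}} :=
  [set [set actPo g x | g in Ggroup S1 S2 start] | x in Po_set S1].

(* N^{(1)}_{S0,S1,S2}(lambda); box (r,c) = row r, column c *)
Definition in_diagram (lam : seq nat) (b : nat * nat) : bool :=
  (b.1 < size lam)%N && (b.2 < nth 0%N lam b.1)%N.

Definition N1 (S0 S1 S2 : {perm T}) (lam : seq nat) : nat :=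
  #|[set f : {ffun T -> 'I_(sumn lam) * 'I_(sumn lam)} |
      [forall l, [&& in_diagram lam ((f l).1 : nat, (f l).2 : nat),
                     f l == f (S0 l),
                     (f l).2 == (f (S1 l)).2 &
                     (f l).1 == (f (S2 l)).1]]]|.

End PairPartitions.

(* Main.v *)
Require Import Defs.
From HB Require Import structures.
From mathcomp Require Import all_boot all_order all_algebra all_fingroup.
From mathcomp Require Import mpoly zify.

(** Let [theta_pairs rho lam] be the sum of the signs of the column-preserving permutations [t]
    of the boxes of [lam], over the couples of [t] and a row-preserving pairing [S] of
    [lam * {red, green}] such that the loops formed by [S] and the pairing "red b -- green (t b)"
    have type [rho].  Two boxes of one column with equal red labels make an alternating sum over
    column permutations vanish; this gives the triangularity and the orthogonality that
    characterise the zonal polynomials, so [theta_pairs] is [theta].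

    On the other side, an orientation together with a filling [f : [2k] -> lam] is a map to
    coloured boxes.  The contributions of a non-injective map cancel in pairs, and an injective
    one is an embedding of the graph of [(S1, S2)] into the graph of some [(t, S)] which is
    trivial off the image.  Counting these embeddings produces the factor
    [2 ^ l(mu) * z_mu * 'C(d + m_1, m_1)], and [2 ^ l(mu)] is the size of every orbit because [G]
    acts freely. *)

Set Implicit Arguments.
Unset Strict Implicit.
Unset Printing Implicit Defensive.
Import GRing.Theory.
Local Open Scope nat_scope.

(** * Loops of two pairings *)

Section Loops.
Variable T : finType.
Implicit Types A B : {perm T}.

(** The obstacle is that [zonal_spec] characterises the zonal coefficients without giving a formula,
    so an explicit candidate is tested against its three conditions. One count serves both halves.
    With no excess boxes, [card_emb] counts isomorphisms of loop graphs; there are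
    $2^{\ell(\rho)}z_\rho$ of them, exactly the weight of the scalar product. An orthogonality sum
    thus becomes a sum over bijections exchanging column pairings with row pairings, and for each
    bijection it factors into two alternating column sums. Orientations make the signs comparable:
    $(-1)^{\mathcal{L}(S_0,S_1)}$ is the sign of $S_0S_1$ on the red elements. An injective coloured
    filling carries that permutation to [t]; a collision allows it to be multiplied by a
    transposition. Only elements of equal colour in one box collide, since the two elements of a
    pair of $S_0$ always share a box. *)

Definition pairing A := [forall x, (A (A x) == x) && (A x != x)].

Lemma pairingP A :
  reflect ((forall x, A (A x) = x) /\ (forall x, A x != x)) (pairing A).
Proof.
apply: (iffP forallP) => [h|[h1 h2] x]; last by rewrite h1 eqxx h2.
by split=> x; case/andP: (h x) => /eqP.
Qed.

Lemma pairingK A : pairing A -> involutive A.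
Proof. by case/pairingP. Qed.

Lemma pairing_neq A x : pairing A -> A x != x.
Proof. by case/pairingP. Qed.

Definition loop A B x : {set T} :=
  [set y | connect [rel x y | (y == A x) || (y == B x)] x y].
Definition gloops A B := [set loop A B x | x : T].
Definition gtype A B := sort geq [seq #|L| %/ 2 | L : {set T} <- enum (gloops A B)].

(** The first step is [B], as in the numbering of $j_{i,1},j_{i,2},\dots$. Even positions then run
    through the orbit of $c=A\circ B$, odd positions through its [B]-image. *)
Fixpoint walk A B (x : T) (t : nat) : T :=
  if t is t'.+1 then (if odd t' then A else B) (walk A B x t') else x.

Variables A B : {perm T}.
Hypotheses (hA : pairing A) (hB : pairing B).

Let c : {perm T} := (B * A)%g.
Let cE x : c x = A (B x). Proof. exact: permM. Qed.

Lemma walk_even x t : walk A B x t.*2 = iter t c x.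
Proof. by elim: t => [|t IH] //=; rewrite odd_double /= IH cE. Qed.

Lemma walk_odd x t : walk A B x t.*2.+1 = B (iter t c x).
Proof. by rewrite /= odd_double walk_even. Qed.

(** The word $Bc^m$ is an odd palindrome in two involutions, hence conjugate to [A] or [B] and free
    of fixed points. The induction strips letters at both ends, lowering [m] by two. *)
Lemma pairing_iter_neq m x : B x != iter m c x.
Proof.
have [m2] := ubnP m; elim: m2 m x => // m2 IH [|[|m]] x hm; first exact: pairing_neq.
  by rewrite /= cE eq_sym pairing_neq.
rewrite iterS iterSr -{1}(pairingK hA (B x)) -cE; move: (c x) => w.
rewrite cE (inj_eq perm_inj) -(inj_eq (@perm_inj _ B)) (pairingK hB).
by apply: IH; apply: ltnW.
Qed.

Lemma pairing_iterK m x : iter m c (B (iter m c x)) = B x.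
Proof.
elim: m x => // m IH x.
by rewrite iterSr iterS !cE !(pairingK hA, pairingK hB) IH.
Qed.

(** [B] inverts $c$, so a meeting of the $c$-orbit with its [B]-image reduces to [pairing_iter_neq].
    Hence the two halves of a loop are disjoint and its length is even. *)
Lemma pairing_iter_sep m n x : B (iter m c x) != iter n c x.
Proof.
have inj : injective (iter m c) by elim: m => // m IH a b /perm_inj /IH.
rewrite -(inj_eq inj) pairing_iterK -iterD.
exact: pairing_iter_neq.
Qed.

Let iter_eq x m n : (iter m c x == iter n c x) = (m == n %[mod #|porbit c x|]).
Proof.
have N0 : 0 < #|porbit c x| by rewrite (cardD1 x) porbit_id.
have h t : iter t c x = iter (t %% #|porbit c x|) c x.
  rewrite [in LHS](divn_eq t #|porbit c x|) addnC iterD; congr iter.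
  by elim: (t %/ _) => // q IH; rewrite mulSn iterD IH iter_porbit.
rewrite (h m) (h n) -(nth_traject c (ltn_pmod m N0)) -(nth_traject c (ltn_pmod n N0)).
by rewrite nth_uniq ?size_traject ?ltn_pmod // uniq_traject_porbit.
Qed.

Lemma loop_refl x : x \in loop A B x. Proof. by rewrite inE connect0. Qed.

Lemma loopP x y : reflect (exists t, y = walk A B x t) (y \in loop A B x).
Proof.
rewrite inE; apply: (iffP idP) => [|[t ->]]; last first.
  elim: t => [|t IH] //=; apply: connect_trans IH (connect1 _) => /=.
  by case: ifP; rewrite eqxx ?orbT.
have prevA z t : z = walk A B x t -> exists u, A z = walk A B x u.
  move=> ->; have [o|e] := boolP (odd t); first by exists t.+1; rewrite /= o.
  have h := odd_double_half t; rewrite (negbTE e) add0n in h.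
  (* Position 0 has no predecessor, so [A] is reached by going forward: all but one of the powers of
     $c$ in a full turn, then one step [B]. *)
  exists (t + #|porbit c x|.-1.*2).+1.
  rewrite -h -doubleD walk_odd walk_even.
  have N0 : 0 < #|porbit c x| by rewrite (cardD1 x) porbit_id.
  apply: (@perm_inj _ A); rewrite (pairingK hA) -cE -iterS -addnS prednK //.
  by rewrite iterD iter_porbit.
have prevB z t : z = walk A B x t -> exists u, B z = walk A B x u.
  move=> ->; have [o|e] := boolP (odd t); last by exists t.+1; rewrite /= (negbTE e).
  have h := odd_double_half t; rewrite o add1n in h.
  by exists t./2.*2; rewrite -[in LHS]h walk_odd walk_even (pairingK hB).
have key p w : path [rel a b | (b == A a) || (b == B a)] w p ->
    (exists t, w = walk A B x t) -> exists t, last w p = walk A B x t.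
  elim: p w => [|z p IH] w //= /andP[hz hp] [t ht]; apply: IH => //.
  by case/orP: hz => /eqP ->; [exact: prevA ht|exact: prevB ht].
by move=> /connectP[p hp ->]; apply: key => //; exists 0.
Qed.

Lemma loop_porbit x : loop A B x = porbit c x :|: B @: porbit c x.
Proof.
apply/setP=> y; rewrite in_setU; apply/loopP/orP => [[t ->]|].
  rewrite -(odd_double_half t); case: (odd t).
    rewrite add1n walk_odd; right; apply: imset_f; rewrite -[iter _ _ _]permX.
    exact: mem_porbit.
  by left; rewrite walk_even -[iter _ _ _]permX; exact: mem_porbit.
case=> [/porbitP[i ->]|/imsetP[z /porbitP[i ->] ->]].
  by exists i.*2; rewrite walk_even permX.
by exists i.*2.+1; rewrite walk_odd permX.
Qed.

Lemma card_loop x : #|loop A B x| = #|porbit c x|.*2.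
Proof.
rewrite loop_porbit cardsU card_imset; last exact: perm_inj.
rewrite (_ : _ :&: _ = set0) ?cards0 ?subn0 ?addnn //.
apply/setP=> y; rewrite !inE; apply/negP=> /andP[/porbitP[i ->] /imsetP[z /porbitP[j ->]]].
by rewrite !permX => /eqP; rewrite eq_sym (negbTE (pairing_iter_sep _ _ _)).
Qed.

Lemma loop_gt0 x : 0 < #|loop A B x|.
Proof. by rewrite (cardD1 x) loop_refl. Qed.

(** The modulus is twice the size of the $c$-orbit, so reduction keeps parity. Positions of opposite
    parity never meet; those of equal parity are compared along the orbit. *)
Lemma walk_eq x t u : (walk A B x t == walk A B x u) = (t == u %[mod #|loop A B x|]).
Proof.
rewrite card_loop -(odd_double_half t) -(odd_double_half u).
case: (odd t) (odd u) => [] []; rewrite ?add1n ?add0n ?walk_odd ?walk_even.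
- by rewrite (inj_eq perm_inj) iter_eq -[_.*2.+1]addn1 -[u./2.*2.+1]addn1 eqn_modDr -!muln2 -!muln_modl eqn_pmul2r.
- rewrite (negbTE (pairing_iter_sep _ _ _)); apply/esym/negbTE/negP=> /eqP /(congr1 odd).
  by rewrite !odd_mod ?odd_double //= odd_double.
- rewrite eq_sym (negbTE (pairing_iter_sep _ _ _)); apply/esym/negbTE/negP=> /eqP /(congr1 odd).
  by rewrite !odd_mod ?odd_double //= odd_double.
- by rewrite iter_eq -!muln2 -!muln_modl eqn_pmul2r.
Qed.

Lemma walk_mod x t : walk A B x (t %% #|loop A B x|) = walk A B x t.
Proof. by apply/eqP; rewrite walk_eq modn_mod. Qed.

Lemma walk_addn x t : walk A B x (t + #|loop A B x|) = walk A B x t.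
Proof. by apply/eqP; rewrite walk_eq modnDr. Qed.

Lemma walkB x t : B (walk A B x t) = walk A B x (if odd t then t.-1 else t.+1).
Proof. by case: ifP => h /=; rewrite ?h //; case: t h => //= t /negbTE ->; rewrite pairingK. Qed.

(** Position 0 is excluded because its [A]-neighbour is the last position of the loop; adding a full
    turn avoids this case. *)
Lemma walkA x t : 0 < t -> A (walk A B x t) = walk A B x (if odd t then t.+1 else t.-1).
Proof. by move=> t0; case: ifP => h /=; rewrite ?h //; case: t t0 h => //= t _ /negbFE ->; rewrite pairingK. Qed.

Lemma loop_mem_walk x t : walk A B x t \in loop A B x.
Proof. by apply/loopP; exists t. Qed.

Lemma loop_memA x y : y \in loop A B x -> A y \in loop A B x.
Proof. by rewrite !inE => h; apply: connect_trans h (connect1 _); rewrite /= eqxx. Qed.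

Lemma loop_memB x y : y \in loop A B x -> B y \in loop A B x.
Proof. by rewrite !inE => h; apply: connect_trans h (connect1 _); rewrite /= eqxx orbT. Qed.

Lemma loop_sym x y : (y \in loop A B x) = (x \in loop A B y).
Proof.
suff h a b : b \in loop A B a -> a \in loop A B b by apply/idP/idP; apply: h.
case/loopP=> t ->; elim: t a => [|t IH] a; first exact: loop_refl.
set w := walk A B a t.+1; have := IH a; rewrite inE.
have hw : walk A B a t \in loop A B w.
  rewrite /w /=; case: (odd t).
    by rewrite -{1}(pairingK hA (walk A B a t)); apply: loop_memA; apply: loop_refl.
  by rewrite -{1}(pairingK hB (walk A B a t)); apply: loop_memB; apply: loop_refl.
by move: hw; rewrite !inE; apply: connect_trans.
Qed.

Lemma loop_eqP x y : (loop A B x == loop A B y) = (x \in loop A B y).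
Proof.
apply/eqP/idP=> [<-|h]; first exact: loop_refl.
have h' : y \in loop A B x by rewrite loop_sym.
move: h h'; rewrite !inE => h h'; apply/setP=> z; rewrite !inE.
by apply/idP/idP; apply: connect_trans.
Qed.

Lemma loop_A x : loop A B (A x) = loop A B x.
Proof. by apply/eqP; rewrite loop_eqP loop_memA ?loop_refl. Qed.

Lemma loop_B x : loop A B (B x) = loop A B x.
Proof. by apply/eqP; rewrite loop_eqP loop_memB ?loop_refl. Qed.

Lemma loop_in x : loop A B x \in gloops A B. Proof. exact: imset_f. Qed.

Lemma gloops_loop L x : L \in gloops A B -> x \in L -> L = loop A B x.
Proof. by case/imsetP=> y _ -> h; apply/eqP; rewrite eq_sym loop_eqP. Qed.

Lemma odd_loop x : odd #|loop A B x| = false.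
Proof. by rewrite card_loop odd_double. Qed.

Lemma loop_half x : #|loop A B x| = (#|loop A B x| %/ 2).*2.
Proof. by rewrite divn2 -[LHS]odd_double_half odd_loop. Qed.

Lemma gloops_partition : partition (gloops A B) [set: T].
Proof.
apply/and3P; split.
- apply/eqP/setP=> x; rewrite in_setT; apply/bigcupP; exists (loop A B x); first exact: loop_in.
  exact: loop_refl.
- apply/trivIsetP=> L M hL hM; apply: contraR => /pred0Pn[x /andP[/= xL xM]].
  by rewrite (gloops_loop hL xL) (gloops_loop hM xM).
- by apply/negP=> /imsetP[x _ /setP/(_ x)]; rewrite in_set0 loop_refl.
Qed.

Lemma sum_card_loops : \sum_(L in gloops A B) #|L| = #|T|.
Proof. by rewrite -cardsT (card_partition gloops_partition). Qed.

Lemma card_loop2 x : (#|loop A B x| == 2) = (A x == B x).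
Proof.
rewrite card_loop -[2]/(1.*2) -!muln2 eqn_pmul2r // -(inj_eq (@perm_inj _ A)) (pairingK hA) -cE.
by have := iter_eq x 1 0; rewrite /= mod0n -[_ == 0]/(_ %| 1) dvdn1 => <-; rewrite eq_sym.
Qed.

Lemma size_gtype : size (gtype A B) = #|gloops A B|.
Proof. by rewrite size_sort size_map -cardE. Qed.

Lemma sumn_gtype : (sumn (gtype A B)).*2 = #|T|.
Proof.
rewrite -sum_card_loops (perm_sumn (permEl (perm_sort _ _))) sumnE big_map big_enum /=.
rewrite -muln2 big_distrl /=; apply: eq_bigr => L /imsetP[x _ ->].
by rewrite muln2 -loop_half.
Qed.

Lemma gtype_partition : is_partition (gtype A B).
Proof.
apply/andP; split; first by apply: sort_sorted => a b; exact: leq_total.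
rewrite all_sort; apply/allP=> m /mapP[L]; rewrite mem_enum => /imsetP[x _ ->] ->.
by have := loop_gt0 x; rewrite [in X in X -> _]loop_half double_gt0.
Qed.

End Loops.

(** * Counting equivariant embeddings *)

Lemma zee_big (r rho : seq nat) : uniq r -> {subset rho <= r} ->
  zee rho = \prod_(i <- r) (i ^ count_mem i rho * (count_mem i rho)`!).
Proof.
move=> ur sub; rewrite (bigID (mem rho)) /= [X in _ * X]big1 ?muln1; last first.
  by move=> i /count_memPn ->; rewrite expn0 fact0.
rewrite -big_filter; apply: perm_big; apply: uniq_perm; rewrite ?undup_uniq ?filter_uniq //.
by move=> i; rewrite mem_undup mem_filter; case: (boolP (i \in rho)) => // /sub ->.
Qed.

Lemma zee_cons x mu : zee (x :: mu) = x * (count_mem x mu).+1 * zee mu.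
Proof.
have ur := undup_uniq (x :: mu).
have sub1 : {subset x :: mu <= undup (x :: mu)} by move=> i; rewrite mem_undup.
have sub2 : {subset mu <= undup (x :: mu)} by move=> i h; rewrite mem_undup inE h orbT.
have xin : x \in undup (x :: mu) by rewrite mem_undup mem_head.
rewrite (zee_big ur sub1) (zee_big ur sub2) !(bigD1_seq x xin ur) /= eqxx add1n.
have e : \prod_(i <- undup (x :: mu) | i != x)
    (i ^ ((x == i) + count_mem i mu) * ((x == i) + count_mem i mu)`!) =
   \prod_(i <- undup (x :: mu) | i != x) (i ^ count_mem i mu * (count_mem i mu)`!).
  by apply: eq_bigr => i ix; rewrite eq_sym (negbTE ix) add0n.
move: e; rewrite /= => ->; rewrite expnS factS; nia.
Qed.

Lemma zee_perm a b : perm_eq a b -> zee a = zee b.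
Proof.
move=> h; have hm := perm_mem h.
have sub : {subset b <= undup a} by move=> i; rewrite mem_undup hm.
rewrite (zee_big (undup_uniq a) sub); apply: eq_bigr => i _.
by rewrite (seq.permP h).
Qed.

(* The number of ways to match pointed loops of half-lengths [a] with loops of half-lengths
   [a ++ nseq d 1]; in [Sigma2] the factor $2^{\ell(\mu)}$ is absent, it is the order of [G]. *)
Definition match_weight (a : seq nat) d :=
  2 ^ size a * zee a * 'C(d + count_mem 1 a, count_mem 1 a).

Lemma match_weight_perm a b d : perm_eq a b -> match_weight a d = match_weight b d.
Proof. by move=> h; rewrite /match_weight (zee_perm h) (perm_size h) (seq.permP h). Qed.

Fixpoint match_count (a b : seq nat) : nat :=
  if a is n :: a' then count_mem n b * n.*2 * match_count a' (rem n b)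
  else all (pred1 1) b.

Lemma match_count_perm a b b' : perm_eq b b' -> match_count a b = match_count a b'.
Proof.
elim: a b b' => [|n a IH] b b' h /=; first by rewrite (perm_all _ h).
rewrite (seq.permP h); congr (_ * _); apply: IH.
case: (boolP (n \in b)) => hn; last by rewrite !rem_id // -(perm_mem h).
rewrite -(perm_cons n) -(permPl (perm_to_rem hn)) (permPl h).
by apply: perm_to_rem; rewrite -(perm_mem h).
Qed.

(** A new part 1 may also go to any of the [d] added loops; the absorption identity for binomials
    turns the factor $m_1+1$ of $z$ into $m_1+d+1$. *)
Lemma match_weight_cons n a d :
  match_weight (n :: a) d = (count_mem n a + (if n == 1 then d else 0)).+1 * n.*2 * match_weight a d.
Proof.
rewrite /match_weight /= zee_cons expnS; case: eqP => [->|_]; last first.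
  rewrite addn0 add0n -!muln2. set u := 2 ^ _. set v := zee a. set w := 'C(_, _). set t := count_mem n a. nia.
have := mul_bin_diag (d + count_mem 1 a).+1 (count_mem 1 a).
rewrite add1n addnS /= => h.
transitivity (2 * 2 ^ size a * zee a * ((count_mem 1 a).+1 * 'C((d + count_mem 1 a).+1, (count_mem 1 a).+1))); first by set u := 2 ^ _; set v := zee a; set t := count_mem 1 a; set w := 'C(_, _); nia.
rewrite -h /= -!muln2.
set u := 2 ^ _; set v := zee a; set w := 'C(_, _); set t := count_mem 1 a; nia.
Qed.

Lemma match_countE a b :
  match_count a b = if perm_eq b (a ++ nseq (size b - size a) 1)
                    then match_weight a (size b - size a) else 0.
Proof.
elim: a b => [|n a IH] b /=.
  rewrite subn0; have -> : all (pred1 1) b = perm_eq b (nseq (size b) 1).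
    apply/idP/idP => [/all_pred1P {1}-> //|h]; rewrite (perm_all _ h).
    by apply/all_pred1P; rewrite size_nseq.
  by case: ifP => // _; rewrite /match_weight /zee /= big_nil bin0.
case: (boolP (n \in b)) => hn; last first.
  rewrite (count_memPn hn) mul0n mul0n ifN //; apply/negP=> /perm_mem/(_ n).
  by rewrite mem_head (negbTE hn).
have e : size (rem n b) - size a = size b - (size a).+1 by rewrite size_rem // -subn1 -subnDA add1n.
rewrite IH e -(perm_cons n) -(permPl (perm_to_rem hn)).
case: ifP => h; last by rewrite muln0.
rewrite match_weight_cons; congr (_ * _ * _); rewrite (seq.permP h) /= eqxx count_cat count_nseq.
by rewrite /= eq_sym; case: (n == 1); rewrite ?mul1n ?mul0n add1n.
Qed.

Lemma uniq_map_inj (U V : eqType) (F : U -> V) s : uniq (map F s) -> {in s &, injective F}.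
Proof.
elim: s => // a s IH /= /andP[na us] x y; rewrite !inE => /predU1P[->|hx] /predU1P[->|hy] //.
- by move=> e; move: na; rewrite e map_f.
- by move=> e; move: na; rewrite -e map_f.
- exact: IH.
Qed.

Lemma map_preimage (U V : eqType) (F : U -> V) (l : seq V) :
  (forall v, v \in l -> exists u, v = F u) -> exists s, map F s = l.
Proof.
elim: l => [|v l IH] h; first by exists [::].
have [u hu] := h v (mem_head _ _).
have [s hs] : exists s, map F s = l by apply: IH => w hw; apply: h; rewrite inE hw orbT.
by exists (u :: s); rewrite /= hs -hu.
Qed.

Section Embeddings.
Variables T X : finType.
Variables (A B : {perm T}) (A' B' : {perm X}).

(** Since [A'] and [B'] agree off the image, every loop missed by [s] has length 2: the target type
    is the source type with parts 1 added. *)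
Definition emb : {set {ffun T -> X}} :=
  [set s : {ffun T -> X} |
    [&& injectiveb s, [forall x, (s (A x) == A' (s x)) && (s (B x) == B' (s x))]
      & [forall y, (y \notin codom s) ==> (A' y == B' y)]]].

Lemma embP (s : {ffun T -> X}) :
  reflect [/\ injective s, forall x, s (A x) = A' (s x), forall x, s (B x) = B' (s x)
            & forall y, y \notin codom s -> A' y = B' y] (s \in emb).
Proof.
rewrite inE; apply: (iffP and3P).
  case=> /injectiveP i /forallP e /forallP o; split=> // [x|x|y].
  - by case/andP: (e x) => /eqP.
  - by case/andP: (e x) => _ /eqP.
  - by move/implyP: (o y) => h /h /eqP.
case=> i eA eB o; split; first exact/injectiveP.
  by apply/forallP=> x; rewrite eA eB !eqxx.
by apply/forallP=> y; apply/implyP=> /o ->.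
Qed.

Hypotheses (hA : pairing A) (hB : pairing B) (hA' : pairing A') (hB' : pairing B').

Local Notation lpX := (loop A' B').
Local Notation lpT := (loop A B).

Lemma equiv_walk (s : T -> X) x t :
  (forall x, s (A x) = A' (s x)) -> (forall x, s (B x) = B' (s x)) ->
  s (walk A B x t) = walk A' B' (s x) t.
Proof. by move=> eA eB; elim: t => //= t IH; case: (odd t); rewrite ?eA ?eB IH. Qed.

Lemma equiv_loop (s : T -> X) x :
  (forall x, s (A x) = A' (s x)) -> (forall x, s (B x) = B' (s x)) ->
  lpX (s x) = s @: lpT x.
Proof.
move=> eA eB; apply/setP=> y; apply/(loopP hA' hB')/imsetP.
  by case=> t ->; exists (walk A B x t); rewrite ?equiv_walk ?loop_mem_walk.
by case=> z /(loopP hA hB)[t ->] ->; exists t; rewrite equiv_walk.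
Qed.

(** An embedding encoded by the images of one base point per source loop; [R] lists the target loops
    that are still free. *)
Fixpoint transversals (a : seq nat) (R : seq {set X}) : seq (seq X) :=
  if a is n :: a' then
    [seq y :: ys | y <- enum [pred y | (lpX y \in R) && (#|lpX y| == n.*2)],
                   ys <- transversals a' (rem (lpX y) R)]
  else if all (fun L : {set X} => #|L| == 2) R then [:: [::]] else [::].

Lemma transversals_uniq a R : uniq (transversals a R).
Proof.
elim: a R => [|n a IH] R /=; first by case: ifP.
apply: allpairs_uniq_dep; [exact: enum_uniq | by move=> y _; exact: IH |].
by move=> [y ys] [z zs] _ _ /= [-> ->].
Qed.

Lemma mem_transversals a (R : seq {set X}) ys : uniq R ->
  (ys \in transversals a R) =
  [&& [seq #|lpX y| | y <- ys] == map double a, uniq (map lpX ys), all (mem R) (map lpX ys)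
    & all (fun L : {set X} => (#|L| == 2) || (L \in map lpX ys)) R].
Proof.
elim: a R ys => [|n a IH] R ys uR /=.
  case: ys => [|y ys] /=; last by case: ifP; rewrite ?inE.
  rewrite (eq_all (a2 := fun L : {set X} => #|L| == 2)); last by move=> L; rewrite orbF.
  by case: ifP; rewrite ?inE.
apply/allpairsPdep/idP.
  case=> y [zs []]; rewrite mem_enum inE => /andP[hR hn] hz ->.
  move: hz; rewrite IH ?rem_uniq // => /and4P[/eqP h1 h2 /allP h3 /allP h4].
  apply/and4P; split=> /=.
  - by rewrite (eqP hn) h1.
  - by rewrite h2 andbT; apply/negP=> /h3; rewrite /= mem_rem_uniq // !inE eqxx.
  - by rewrite hR /=; apply/allP=> L /h3 /=; apply: mem_rem.
  - apply/allP=> L hL; rewrite inE; case: (eqVneq L (lpX y)) => [|ne]; first by rewrite orbT.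
    by apply: h4; rewrite mem_rem_uniq // !inE ne.
case: ys => [|y ys] //= /and4P[/eqP[h1 h1'] /andP[h2 h2'] /andP[h3 /allP h3'] /allP h4].
exists y, ys; split=> //; first by rewrite mem_enum inE h3 h1 eqxx.
rewrite IH ?rem_uniq // h1' eqxx h2' /=; apply/andP; split.
  apply/allP=> L hL; rewrite /= mem_rem_uniq // !inE; have /= -> := h3' _ hL; rewrite andbT.
  by apply: contraNneq h2 => <-.
apply/allP=> L; rewrite mem_rem_uniq // !inE => /andP[ne hL].
by have := h4 _ hL; rewrite inE (negbTE ne).
Qed.

Lemma size_transversals a R : uniq R -> {subset R <= gloops A' B'} ->
  size (transversals a R) = match_count a [seq #|L| %/ 2 | L : {set X} <- R].
Proof.
elim: a R => [|n a IH] R uR sR /=.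
  rewrite all_map; case: ifP => [h|/negbT h]; rewrite /= ?(eq_in_all (a2 := fun L : {set X} => #|L| == 2)).
  - by rewrite h.
  - move=> L /sR /imsetP[x _ ->] /=; rewrite [in RHS](loop_half hA' hB'); lia.
  - by rewrite (negbTE h).
  - move=> L /sR /imsetP[x _ ->] /=; rewrite [in RHS](loop_half hA' hB'); lia.
set b := map (fun L : {set X} => #|L| %/ 2) R.
rewrite size_allpairs_dep sumnE big_map big_enum /=.
rewrite (eq_bigr (fun=> match_count a (rem n b))); last first.
  move=> y; rewrite inE => /andP[yR /eqP yn].
  rewrite IH ?rem_uniq //; last by move=> L /mem_rem /sR.
  apply: match_count_perm.
  have hn : #|lpX y| %/ 2 = n by rewrite yn -muln2 mulnK.
  rewrite -(perm_cons n) -{1}hn -[_ :: _]/(map (fun L : {set X} => #|L| %/ 2) (lpX y :: rem (lpX y) R)).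
  rewrite -(permPl (perm_map _ (perm_to_rem yR))); apply: perm_to_rem.
  by rewrite -hn; apply: map_f.
rewrite sum_nat_const; congr (_ * _).
(* Base points are grouped by loop: each free loop of length $2n$ offers all of its $2n$
   elements. *)
rewrite -sum1_card (partition_big lpX (fun L => (L \in R) && (#|L| == n.*2))) //=.
rewrite (eq_bigr (fun=> n.*2)); last first.
  move=> L /andP[LR Ln]; rewrite -(eqP Ln) -sum1_card; apply: eq_bigl => y.
  have [x _ e] := imsetP (sR _ LR).
  apply/andP/idP => [[_ /eqP <-]|hy]; first exact: loop_refl.
  move: hy; rewrite e -(loop_eqP hA' hB') => /eqP eq; rewrite -eq in e; rewrite e in LR Ln.
  split; last by rewrite eq.
  by rewrite inE LR /= sum1_card eq eqxx.
rewrite sum_nat_const; congr (_ * _); rewrite count_map -size_filter cardE.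
apply/eqP; rewrite -uniq_size_uniq ?enum_uniq ?filter_uniq // => L.
rewrite mem_enum mem_filter [RHS]unfold_in /=.
case: (boolP (L \in R)) => [/sR /imsetP[x _ ->]|_]; rewrite ?andbT ?andbF //=.
by rewrite [in RHS](loop_half hA' hB') -!muln2 eqn_pmul2r.
Qed.

(** Walking in parallel from the base points forces the map. It is well defined because
    corresponding loops have equal length, and injective because distinct loops go to distinct
    loops. *)
Lemma emb_of_transversal (st : seq T) (ys : seq X) :
  map lpT st = enum (gloops A B) ->
  [seq #|lpX y| | y <- ys] = [seq #|lpT x| | x <- st] -> uniq (map lpX ys) ->
  (forall y, lpX y \notin map lpX ys -> A' y = B' y) ->
  exists2 s, s \in emb & map s st = ys.
Proof.
move=> hst hc uys off.
have ust : uniq (map lpT st) by rewrite hst enum_uniq.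
have hsz : size st = size ys by rewrite -(size_map (fun x => #|lpT x|)) -hc size_map.
set zs := zip st ys.
have hz1 : map fst zs = st by rewrite -/unzip1 unzip1_zip ?hsz.
have hz2 : map snd zs = ys by rewrite -/unzip2 unzip2_zip ?hsz.
have zc p : p \in zs -> #|lpX p.2| = #|lpT p.1|.
  have : [seq #|lpX p.2| | p <- zs] = [seq #|lpT p.1| | p <- zs].
    by rewrite (map_comp (fun y => #|lpX y|) snd) hz2 hc -hz1 -map_comp.
  by move/eq_in_map; apply.
have inj1 : {in zs &, injective (lpT \o fst)} by apply: uniq_map_inj; rewrite map_comp hz1.
have inj2 : {in zs &, injective (lpX \o snd)} by apply: uniq_map_inj; rewrite map_comp hz2.
have ex (x : T) : exists v : X, exists p t, [/\ p \in zs, x = walk A B p.1 t & v = walk A' B' p.2 t].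
  have : lpT x \in map lpT st by rewrite hst mem_enum loop_in.
  rewrite -hz1 -map_comp => /mapP[p hp /= e].
  have /(loopP hA hB)[t ht] : x \in lpT p.1 by rewrite -e loop_refl.
  by exists (walk A' B' p.2 t), p, t.
have [f hf] := fin_all_exists ex; pose s := [ffun x => f x].
have sE p t : p \in zs -> s (walk A B p.1 t) = walk A' B' p.2 t.
  move=> hp; rewrite ffunE; have [q [u [hq e ->]]] := hf (walk A B p.1 t).
  have epq : p = q.
    apply: inj1 => //=; apply/eqP; rewrite loop_eqP // loop_sym //.
    have := loop_mem_walk hA hB p.1 t; rewrite -(loop_eqP hA hB) => /eqP <-.
    by rewrite e (loop_sym hA hB) loop_mem_walk.
  subst q; move/eqP: e; rewrite walk_eq // => /eqP e.
  by apply/eqP; rewrite walk_eq // (zc _ hp) e.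
(* A full turn makes the position positive, as [walkA] requires. *)
have ex2 (x : T) : exists p t, [/\ p \in zs, 0 < t & x = walk A B p.1 t].
  have [p [t [hp e _]]] := hf x; exists p, (t + #|lpT p.1|); split=> //.
    by rewrite addn_gt0 loop_gt0 orbT.
  by rewrite walk_addn.
exists s; last first.
  rewrite -hz1 -[RHS]hz2 -map_comp; apply/eq_in_map => p hp /=.
  exact: (sE p 0 hp).
apply/embP; split.
- move=> x x'; have [p [t [hp _ ->]]] := ex2 x; have [q [u [hq _ ->]]] := ex2 x'.
  rewrite !sE // => e; have epq : p = q.
    apply: inj2 => //=; apply/eqP; rewrite loop_eqP // loop_sym //.
    have := loop_mem_walk hA' hB' p.2 t; rewrite -(loop_eqP hA' hB') => /eqP <-.
    by rewrite e (loop_sym hA' hB') loop_mem_walk.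
  subst q; move/eqP: e; rewrite walk_eq // (zc _ hp) => e.
  by apply/eqP; rewrite walk_eq.
- move=> x; have [p [t [hp t0 ->]]] := ex2 x.
  by rewrite walkA // !sE // walkA.
- move=> x; have [p [t [hp t0 ->]]] := ex2 x.
  by rewrite walkB // !sE // walkB.
- move=> y hy; apply: off; apply: contra hy; rewrite -hz2 -map_comp => /mapP[p hp /= e].
  have /(loopP hA' hB')[t ->] : y \in lpX p.2 by rewrite -e loop_refl.
  by rewrite -sE //; apply: codom_f.
Qed.

Lemma card_emb_transversals : #|emb| =
  size (transversals [seq #|L| %/ 2 | L : {set T} <- enum (gloops A B)] (enum (gloops A' B'))).
Proof.
have [st hst] : exists st, map lpT st = enum (gloops A B).
  by apply: map_preimage => L; rewrite mem_enum => /imsetP[x _ ->]; exists x.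
have inl x : exists2 z, z \in st & x \in lpT z.
  have : lpT x \in map lpT st by rewrite hst mem_enum loop_in.
  by case/mapP=> z hz e; exists z; rewrite // -e loop_refl.
have ust : uniq (map lpT st) by rewrite hst enum_uniq.
set a := [seq _ | _ <- _].
have ha : map double a = [seq #|lpT x| | x <- st].
  rewrite /a -hst -!map_comp; apply: eq_map => x /=.
  by rewrite -loop_half.
rewrite cardE -(size_map (fun s : {ffun T -> X} => map s st)).
apply/eqP; rewrite -uniq_size_uniq ?transversals_uniq //.
  rewrite map_inj_in_uniq ?enum_uniq // => s s'; rewrite !mem_enum.
  case/embP=> _ eA eB _ /embP[_ eA' eB' _] /eq_in_map h.
  apply/ffunP=> x; have [z hz /(loopP hA hB)[t ->]] := inl x.
  by rewrite !equiv_walk // h.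
move=> ys; rewrite mem_transversals ?enum_uniq // ha.
apply/idP/mapP.
  case/and4P=> /eqP h1 h2 _ /allP h4.
  have [|s hs <-] := emb_of_transversal hst h1 h2; last by exists s; rewrite ?mem_enum.
  move=> y /negbTE hy; have := h4 (lpX y); rewrite mem_enum loop_in hy orbF card_loop2 // => /(_ isT).
  by move/eqP.
case=> s; rewrite mem_enum => /embP[inj eA eB off] ->.
have hl x : lpX (s x) = s @: lpT x by rewrite equiv_loop.
apply/and4P; split.
- by rewrite -map_comp; apply/eqP; apply: eq_map => x /=; rewrite hl card_imset.
- rewrite -map_comp (eq_map (g := fun x => s @: lpT x)) => [|x]; last exact: hl.
  by rewrite (map_comp (fun L : {set T} => s @: L) lpT) map_inj_uniq //; apply: imset_inj.
- by apply/allP=> L /mapP[x _ ->]; rewrite /= mem_enum loop_in.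
apply/allP=> L; rewrite mem_enum => /imsetP[y _ ->].
rewrite card_loop2 //; case: (boolP (y \in codom s)) => [/codomP[x ->]|/off ->]; last by rewrite eqxx.
have [z hz hx] := inl x; apply/orP; right.
have e : lpX (s x) = lpX (s z).
  by apply/eqP; rewrite loop_eqP // hl imset_f.
by rewrite e -map_comp; apply: map_f.
Qed.

(** Here [d] is the number of loops of length 2 that an image misses. The case $d=0$ counts
    isomorphisms and yields the weight of the scalar product. *)
Theorem card_emb d : #|X| = #|T| + d.*2 ->
  #|emb| = if gtype A' B' == sort geq (gtype A B ++ nseq d 1)
           then match_weight (gtype A B) d else 0.
Proof.
move=> hd; rewrite card_emb_transversals size_transversals ?enum_uniq //; last first.
  by move=> L; rewrite mem_enum.
rewrite match_countE.
set a := map (fun L : {set T} => #|L| %/ 2) (enum (gloops A B)).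
set b := map (fun L : {set X} => #|L| %/ 2) (enum (gloops A' B')).
have pa : perm_eq a (gtype A B) by rewrite perm_sym; apply: permEl; exact: perm_sort.
have pb : perm_eq b (gtype A' B') by rewrite perm_sym; apply: permEl; exact: perm_sort.
have geq_tr : transitive geq by move=> x y z h1 h2; apply: leq_trans h2 h1.
have geq_as : antisymmetric geq by move=> x y; rewrite andbC; apply: anti_leq.
have geq_to : total geq by move=> x y; apply: leq_total.
have -> : (gtype A' B' == sort geq (gtype A B ++ nseq d 1)) = perm_eq b (a ++ nseq d 1).
  rewrite -[gtype A' B'](sorted_sort geq_tr); last by case/andP: (gtype_partition hA' hB').
  apply: (@etrans _ _ (perm_eq (gtype A' B') (gtype A B ++ nseq d 1))).
    by apply: (sameP eqP); apply: (perm_sortP geq_to geq_tr geq_as).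
  have pc : perm_eq (a ++ nseq d 1) (gtype A B ++ nseq d 1) by rewrite perm_cat2r.
  by rewrite -(permPl pb) (permPr pc).
case: ifP => [h|/negbT h].
  have hs : size b - size a = d.
    have := perm_sumn h; rewrite sumn_cat sumn_nseq mul1n.
    rewrite (perm_sumn pa) (perm_sumn pb).
    have e1 := sumn_gtype hA hB; have e2 := sumn_gtype hA' hB' => e3.
    have := perm_size h; rewrite size_cat size_nseq; lia.
  by rewrite -hs h; apply: match_weight_perm.
rewrite ifN //; apply: contra h => h.
suff <- : d = size b - size a by [].
by have := perm_size h; rewrite size_cat size_nseq => ->; rewrite addKn.
Qed.

End Embeddings.

(** * Signs *)

Section LoopParity.
Variables (T : finType) (A B : {perm T}) (phi : T -> bool).
Hypotheses (hA : pairing A) (hB : pairing B).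
Hypotheses (phiA : forall x, phi (A x) = ~~ phi x) (phiB : forall x, phi (B x) = ~~ phi x).

(** The composite of the two pairings preserves colours, so it restricts to the red elements and
    extends by the identity to the green ones. *)
Lemma red_perm_exists :
  exists p : {perm T}, forall x, p x = if phi x then A (B x) else x.
Proof.
pose f x := if phi x then A (B x) else x.
have hf x : phi (f x) = phi x by rewrite /f; case: ifP => h //; rewrite phiA phiB negbK.
have inj : injective f.
  move=> x y e; have h : phi x = phi y by rewrite -hf e hf.
  by move: e; rewrite /f h; case: ifP => // _ /perm_inj /perm_inj.
by exists (perm inj) => x; rewrite permE.
Qed.

Lemma card_green : #|[set x | ~~ phi x]|.*2 = #|T|.
Proof.
have e : A @: [set x | ~~ phi x] = ~: [set x | ~~ phi x].
  apply/setP=> x; rewrite !inE negbK; apply/imsetP/idP.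
    by case=> y; rewrite inE => hy ->; rewrite phiA.
  by move=> hx; exists (A x); rewrite ?inE ?phiA ?negbK // pairingK.
rewrite -cardsT -(cardsID [set x | ~~ phi x] setT) setTI setTD -e.
by rewrite card_imset ?addnn //; exact: perm_inj.
Qed.

Variable p : {perm T}.
Hypothesis pE : forall x, p x = if phi x then A (B x) else x.

Lemma porbit_green x : ~~ phi x -> porbit p x = [set x].
Proof.
move=> hx; apply/setP=> y; rewrite inE; apply/porbitP/eqP => [[i ->]|->]; last first.
  by exists 0; rewrite expg0 perm1.
by elim: i => [|i IH]; rewrite ?expg0 ?perm1 // expgSr permM IH pE (negbTE hx).
Qed.

Lemma porbit_red x : phi x -> porbit p x = loop A B x :&: [set x | phi x].
Proof.
move=> hx; have key i : (p ^+ i)%g x = ((B * A) ^+ i)%g x /\ phi ((p ^+ i)%g x).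
  elim: i => [|i [IH1 IH2]]; first by rewrite !expg0 perm1.
  by rewrite !expgSr !permM -IH1 pE IH2 phiA phiB IH2.
apply/setP=> y; rewrite loop_porbit // !inE; apply/porbitP/andP.
  by case=> i ->; have [e h] := key i; rewrite h e mem_porbit.
case=> /orP[/porbitP[i ->] _|/imsetP[z /porbitP[i ->] ->]].
  by exists i; case: (key i).
by rewrite phiB; have [<- ->] := key i.
Qed.

(** Loops alternate in colour, and the red half of each is a single cycle of [p]; each green element
    is a fixed point. *)
Lemma card_porbits_red : #|porbits p| = #|gloops A B| + #|[set x | ~~ phi x]|.
Proof.
have redL L : L \in gloops A B -> exists2 x, x \in L & phi x.
  case/imsetP=> x _ ->; case h: (phi x); first by exists x; rewrite ?loop_refl.
  by exists (A x); rewrite ?phiA ?h // loop_memA // loop_refl.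
have -> : porbits p = [set L :&: [set x | phi x] | L in gloops A B] :|: set1 @: [set x | ~~ phi x].
  apply/setP=> C; rewrite inE; apply/imsetP/orP.
    case=> x _ ->; case: (boolP (phi x)) => hx; [left|right].
      by rewrite porbit_red //; apply/imsetP; exists (loop A B x); rewrite ?loop_in.
    by rewrite porbit_green //; apply: imset_f; rewrite inE.
  case=> /imsetP[].
    move=> L hL ->; have [x hx px] := redL L hL; exists x => //.
    by rewrite porbit_red // (gloops_loop hA hB hL hx).
  by move=> x; rewrite inE => hx ->; exists x; rewrite ?porbit_green.
rewrite cardsU (_ : _ :&: _ = set0) ?cards0 ?subn0.
  congr (_ + _); last by rewrite card_imset //; exact: set1_inj.
  apply: card_in_imset => L M hL hM /setP e; have [x hx px] := redL L hL.
  have := e x; rewrite !inE hx px !andbT => /esym hM'.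
  by rewrite (gloops_loop hA hB hL hx) (gloops_loop hA hB hM hM').
apply/setP=> C; rewrite !inE; apply/negP=> /andP[/imsetP[L hL ->] /imsetP[x]].
rewrite inE => hx /setP e; have [y hy py] := redL L hL.
have := e y; rewrite !inE hy py => /esym/eqP yx.
by rewrite yx (negbTE hx) in py.
Qed.

(** Loops have at least two elements. This makes the truncated subtraction in [loop_sign] a genuine
    one. *)
Lemma card_gloops_le k : #|T| = k.*2 -> #|gloops A B| <= k.
Proof.
move=> hT; have := sumn_gtype hA hB; rewrite hT => /double_inj <-.
rewrite -size_gtype; have /andP[_] := gtype_partition hA hB.
by elim: (gtype A B) => //= a s IH /andP[a0 /IH]; lia.
Qed.

(** On $2k$ points [p] has $k$ green fixed points and one further cycle per loop, so its parity is
    that of $2k-k-|\mathcal{L}(A,B)|$. *)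
Lemma sign_loops k : #|T| = k.*2 -> ((-1) ^+ (k - #|gloops A B|) = (-1) ^+ p :> rat)%R.
Proof.
move=> hT; rewrite -signr_odd /odd_perm; congr (_ ^+ nat_of_bool _)%R.
have hg : #|[set x | ~~ phi x]| = k by apply: double_inj; rewrite card_green.
rewrite card_porbits_red hg hT odd_double /= oddD oddB ?card_gloops_le //.
by rewrite addbC.
Qed.

End LoopParity.

(** A factorisation of [p] into transpositions is carried by [s] to a factorisation of [q] of the
    same length. *)
Lemma odd_perm_transport (T X : finType) (s : T -> X) (p : {perm T}) (q : {perm X}) :
  injective s -> (forall x, q (s x) = s (p x)) -> (forall y, y \notin codom s -> q y = y) ->
  odd_perm q = odd_perm p.
Proof.
move=> inj eq off; have [ts ep dts] := prod_tpermP p.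
pose ts' := [seq (s t.1, s t.2) | t <- ts].
have h1 x : (\prod_(t <- ts') tperm t.1 t.2)%g (s x) = s ((\prod_(t <- ts) tperm t.1 t.2)%g x).
  rewrite /ts' big_map; elim: (ts) x => [|t r IH] x; first by rewrite !big_nil !perm1.
  by rewrite !big_cons !permM -IH (inj_tperm _ _ _ inj).
have h2 y : y \notin codom s -> (\prod_(t <- ts') tperm t.1 t.2)%g y = y.
  move=> hy; rewrite /ts' big_map; elim: (ts) => [|t r IH]; first by rewrite big_nil perm1.
  rewrite big_cons permM tpermD ?IH //=; by apply: contraNneq hy => <-; exact: codom_f.
have -> : q = (\prod_(t <- ts') tperm t.1 t.2)%g.
  apply/permP=> y; case: (boolP (y \in codom s)) => [/codomP[x ->]|hy].
    by rewrite eq h1 -ep.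
  by rewrite off ?h2.
rewrite ep !odd_perm_prod ?size_map //.
by rewrite /ts' all_map; apply: sub_all dts => t; rewrite /dpair /= (inj_eq inj).
Qed.

(** * Colour-swapping pairings of coloured boxes *)

Section Twist.
Variable Box : finType.
Implicit Types t : {perm Box}.

Definition twist_fun t (x : Box * bool) := ((if x.2 then t x.1 else (t^-1)%g x.1), ~~ x.2).

Lemma twist_funK t : involutive (twist_fun t).
Proof. by case=> b [] /=; rewrite /twist_fun /= ?permK ?permKV. Qed.

(* The pairing of $\lambda\times\{\mathrm{red},\mathrm{green}\}$ that matches the red copy of [b]
   with the green copy of [t b]. *)
Definition twist t : {perm Box * bool} := perm (inv_inj (@twist_funK t)).

Lemma twistE t x : twist t x = twist_fun t x. Proof. by rewrite permE. Qed.

Lemma twist_pairing t : pairing (twist t).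
Proof.
apply/pairingP; split=> x; rewrite !twistE ?twist_funK //.
by apply/eqP=> /(congr1 snd) /=; case: x.2.
Qed.

Lemma twist_color t x : (twist t x).2 = ~~ x.2. Proof. by rewrite twistE. Qed.

Lemma twist_inj : injective twist.
Proof. by move=> t u e; apply/permP=> b; have := congr1 (fun q : {perm _} => q (b, true)) e; rewrite !twistE => -[]. Qed.

Lemma twist1E x : twist 1 x = (x.1, ~~ x.2).
Proof. by rewrite twistE /twist_fun perm1 invg1 perm1 if_same. Qed.

(** The red copy determines [t], and involutivity then forces the values on the green copy. *)
Lemma twist_of_pairing (A : {perm Box * bool}) : pairing A ->
  (forall x, (A x).2 = ~~ x.2) -> exists t, A = twist t.
Proof.
move=> hA hc; have e b c : A (b, c) = ((A (b, c)).1, ~~ c).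
  by rewrite [LHS]surjective_pairing hc.
have inj : injective (fun b => (A (b, true)).1).
  move=> b b' h; have : A (b, true) = A (b', true) by rewrite e h -e.
  by move/perm_inj=> [].
exists (perm inj); apply/permP=> -[b c]; rewrite twistE /twist_fun /= [LHS]e.
congr (_, _); case: c; first by rewrite permE.
have [b' ->] : exists b', b = perm inj b' by exists ((perm inj)^-1%g b); rewrite permKV.
by rewrite permK permE /= -[((A _).1, false)](e b' true) pairingK.
Qed.

(** [q] is the red permutation attached to [twist 1] and [twist t]; on the red copy of the boxes it
    is [t] itself. *)
Lemma odd_perm_twist t (q : {perm Box * bool}) :
  (forall x, q x = if x.2 then twist 1 (twist t x) else x) -> odd_perm q = odd_perm t.
Proof.
move=> hq; apply: (@odd_perm_transport _ _ (fun b => (b, true))) => [b b' [] //|b|[b []]].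
- by rewrite hq /= twist1E twistE.
- by case/negP; apply/codomP; exists b.
- by rewrite hq.
Qed.

End Twist.

(** * The sum over injective and non-injective fillings *)

Lemma eq_big_unique (V : nmodType) (I J : finType) (P : pred I) (Q : pred J)
    (F : I -> V) (G : J -> V) :
  (forall i i', P i -> P i' -> i = i') -> (forall j j', Q j -> Q j' -> j = j') ->
  (forall i, P i -> exists j, Q j) -> (forall j, Q j -> exists i, P i) ->
  (forall i j, P i -> Q j -> F i = G j) ->
  (\sum_(i | P i) F i = \sum_(j | Q j) G j)%R.
Proof.
move=> uP uQ PQ QP FG; case: (pickP P) => [i Pi|P0].
  have [j Qj] := PQ i Pi.
  rewrite (big_pred1 i) => [|i']; last first.
    by apply/idP/eqP => [Pi'|->] //; exact: uP.
  rewrite (big_pred1 j) => [|j']; last first.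
    by apply/idP/eqP => [Qj'|->] //; exact: uQ.
  exact: FG.
rewrite !big_pred0 // => j; apply/negP=> /QP[i Pi].
by rewrite P0 in Pi.
Qed.

Section Transport.
Variables (T X : finType) (s : T -> X).
Hypothesis inj : injective s.

Lemma pairing_pushforward (P : {perm T}) (F : {perm X}) : pairing P -> pairing F ->
  (forall y, y \notin codom s -> F y \notin codom s) ->
  exists P' : {perm X}, [/\ pairing P', forall x, P' (s x) = s (P x)
                          & forall y, y \notin codom s -> P' y = F y].
Proof.
move=> hP hF off.
pose f y := if [pick x | s x == y] is Some x then s (P x) else F y.
have f1 x : f (s x) = s (P x).
  by rewrite /f; case: pickP => [z /eqP/inj -> //|/(_ x)]; rewrite eqxx.
have f2 y : y \notin codom s -> f y = F y.
  move=> hy; rewrite /f; case: pickP => // x /eqP e.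
  by rewrite -e codom_f in hy.
have cases (R : X -> Prop) : (forall x, R (s x)) -> (forall y, y \notin codom s -> R y) -> forall y, R y.
  by move=> r1 r2 y; case: (boolP (y \in codom s)) => [/codomP[x ->]|]; auto.
have fK : involutive f.
  apply: cases => [x|y hy]; first by rewrite !f1 pairingK.
  by rewrite [f y]f2 // f2 ?off // pairingK.
exists (perm (inv_inj fK)); split=> [|x|y hy]; rewrite ?permE ?f1 ?f2 //.
apply/pairingP; split=> y; rewrite !permE ?fK //.
move: y; apply: cases => [x|y hy]; first by rewrite f1 (inj_eq inj) pairing_neq.
by rewrite f2 // pairing_neq.
Qed.

Lemma pairing_pullback (F : {perm X}) : pairing F -> (forall x, F (s x) \in codom s) ->
  exists P : {perm T}, pairing P /\ forall x, s (P x) = F (s x).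
Proof.
move=> hF hs; have [f hf] : exists f : T -> T, forall x, s (f x) = F (s x).
  by apply: (@fin_all_exists _ (fun=> T) (fun x y => s y = F (s x))) => x; have /codomP[y e] := hs x; exists y.
have fK : involutive f by move=> x; apply: inj; rewrite !hf pairingK.
exists (perm (inv_inj fK)); split=> [|x]; last by rewrite permE.
apply/pairingP; split=> x; rewrite !permE ?fK //.
by rewrite -(inj_eq inj) hf pairing_neq.
Qed.

End Transport.

Section MainSum.
Variables (T : finType) (k : nat) (S1 S2 : {perm T}).
Hypotheses (hT : #|T| = k.*2) (h1 : pairing S1) (h2 : pairing S2).
Variables (Box : finType) (row col : Box -> nat).
Hypothesis box_inj : forall b b', row b = row b' -> col b = col b' -> b = b'.
Local Notation X := (Box * bool)%type.

Definition colstab := [set t : {perm Box} | [forall b, col (t b) == col b]].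
Definition rowpair :=
  [set S : {perm X} | pairing S && [forall x, row (S x).1 == row x.1]].

Lemma colstabP (t : {perm Box}) : reflect (forall b, col (t b) = col b) (t \in colstab).
Proof. by rewrite inE; apply: (iffP forallP) => h b; have := h b => /eqP. Qed.

Lemma rowpairP (S : {perm X}) :
  reflect (pairing S /\ forall x, row (S x).1 = row x.1) (S \in rowpair).
Proof.
rewrite inE; apply: (iffP andP) => -[hS h]; split=> //.
  by move=> x; apply/eqP; apply: (forallP h).
by apply/forallP=> x; rewrite h.
Qed.

Lemma col_twist (t : {perm Box}) x : t \in colstab -> col (twist t x).1 = col x.1.
Proof.
move/colstabP=> h; rewrite twistE /twist_fun /=; case: x.2; rewrite ?h //.
by rewrite -[in RHS](permKV t x.1) h.
Qed.

(* A filling [s] is the couple of [f : T -> Box] and of the orientation, as one map to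
   coloured boxes; the pairing [S0] is then a lift of the colour swap [twist 1]. *)
Definition admissible (s : {ffun T -> X}) :=
  [forall i, [&& (s (S1 i)).2 != (s i).2, col (s (S1 i)).1 == col (s i).1
               & row (s (S2 i)).1 == row (s i).1]].

Lemma admissibleP (s : {ffun T -> X}) :
  reflect [/\ forall i, (s (S1 i)).2 = ~~ (s i).2, forall i, col (s (S1 i)).1 = col (s i).1
            & forall i, row (s (S2 i)).1 = row (s i).1] (admissible s).
Proof.
apply: (iffP forallP) => [h|[a b c] i]; last by rewrite a b c !eqxx; case: (s i).2.
split=> i; case/and3P: (h i) => a /eqP b /eqP c //.
by case: (s (S1 i)).2 (s i).2 a => [] [].
Qed.

Definition lifts (s : {ffun T -> X}) (S0 : {perm T}) :=
  pairing S0 && [forall i, s (S0 i) == twist 1 (s i)].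

Lemma liftsP (s : {ffun T -> X}) S0 :
  reflect (pairing S0 /\ forall i, s (S0 i) = twist 1 (s i)) (lifts s S0).
Proof.
apply: (iffP andP) => -[hS h]; split=> //.
  by move=> x; apply/eqP; apply: (forallP h).
by apply/forallP=> x; rewrite h.
Qed.

Local Open Scope ring_scope.

Let sg (S0 : {perm T}) : rat := (-1) ^+ (k - #|gloops S0 S1|).

(* If [s x = s y], conjugating [S0] by the transposition [(x y)] reverses the sign. *)
Lemma sum_lifts_noninjective (s : {ffun T -> X}) : admissible s -> ~~ injectiveb s ->
  \sum_(S0 | lifts s S0) sg S0 = 0.
Proof.
case/admissibleP=> c1 _ _ /injectivePn[x [y nxy exy]].
have involt : (tperm x y)^-1%g = tperm x y by rewrite tpermV.
set t := tperm x y in involt.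
have st z : s (t z) = s z by rewrite /t; case: tpermP => // ->.
have liftJ S0 : lifts s S0 -> lifts s (S0 ^ t)%g.
  case/liftsP=> hS e; have E z : (S0 ^ t)%g z = t (S0 (t z)) by rewrite conjgE !permM involt.
  have tK z : t (t z) = z by rewrite tpermK.
  apply/liftsP; split=> [|z]; last by rewrite E st e st.
  apply/pairingP; split=> z; rewrite !E; first by rewrite tK pairingK // tK.
  by rewrite -(inj_eq (@perm_inj _ t)) tK pairing_neq.
have tt : (t * t = 1)%g by rewrite -{1}involt mulVg.
have liftJ' S0 : lifts s (S0 ^ t)%g = lifts s S0.
  by apply/idP/idP=> /liftJ //; rewrite -conjgM tt conjg1.
have sgJ S0 : lifts s S0 -> sg (S0 ^ t)%g = - sg S0.
  move=> hl; have /liftsP[hSt et] := liftJ _ hl; case/liftsP: hl => hS e.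
  (* The common colour of [x] and [y] is taken as red. The transposition then moves red elements
     only, and the red permutation of the conjugated pairing is [p * t], of opposite sign. *)
  pose phi z := (s z).2 == (s x).2.
  have nb (a b : bool) : (~~ a == b) = ~~ (a == b) by case: a b => [] [].
  have p1 z : phi (S1 z) = ~~ phi z by rewrite /phi c1 nb.
  have p0 z : phi (S0 z) = ~~ phi z by rewrite /phi e twist_color nb.
  have p0t z : phi ((S0 ^ t)%g z) = ~~ phi z by rewrite /phi et twist_color nb.
  have [p hp] := red_perm_exists p0 p1.
  have tfix z : ~~ phi z -> t z = z.
    by move=> hz; rewrite /t tpermD //; apply: contraNneq hz => <-; rewrite /phi -?exy.
  have hpt z : (p * t)%g z = if phi z then (S0 ^ t)%g (S1 z) else z.
    rewrite permM hp; case: ifP => [hz|/negbT/tfix //].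
    by rewrite conjgE !permM involt (tfix (S1 z)) // p1 hz.
  rewrite /sg (sign_loops hSt h1 p0t p1 hpt hT) (sign_loops hS h1 p0 p1 hp hT).
  by rewrite odd_permM odd_tperm nxy signr_addb mulrN1.
suff /eqP : \sum_(S0 | lifts s S0) sg S0 = - \sum_(S0 | lifts s S0) sg S0.
  by rewrite -subr_eq0 opprK -mulr2n -mulr_natl mulf_eq0 => /orP[|/eqP].
rewrite -sumrN [LHS](reindex_inj (conjg_inj t)) /=.
by apply: eq_big => S0; [exact: liftJ' | rewrite liftJ' => /sgJ ->].
Qed.

Lemma emb_admissible (t : {perm Box}) S s : t \in colstab -> S \in rowpair ->
  s \in emb S1 S2 (twist t) S -> admissible s.
Proof.
move=> ht /rowpairP[_ hS] /embP[_ e1 e2 _]; apply/admissibleP; split=> i.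
- by rewrite e1 twist_color.
- by rewrite e1 col_twist.
- by rewrite e2.
Qed.

(* Off the image [twist t] and [S] agree, so they move a box neither out of its column nor
   out of its row. *)
Lemma emb_twist1 (t : {perm Box}) S s : t \in colstab -> S \in rowpair ->
  s \in emb S1 S2 (twist t) S ->
  forall y, y \notin codom s -> twist t y = twist 1 y.
Proof.
move=> ht /rowpairP[_ hS] /embP[_ e1 e2 off] y hy.
rewrite [RHS]twist1E [LHS]surjective_pairing twist_color; congr (_, _).
by apply: box_inj; rewrite ?col_twist // off // hS.
Qed.

(** Each side has at most one term: [s] determines $S_0$, and it determines [t] and [S] on its
    image, off which they are trivial. A term on one side produces one on the other, of equal
    sign. *)
Lemma sum_lifts_injective (s : {ffun T -> X}) : admissible s -> injective s ->
  \sum_(S0 | lifts s S0) sg S0 =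
  \sum_(q | (q.1 \in colstab) && (q.2 \in rowpair) && (s \in emb S1 S2 (twist q.1) q.2)) (-1) ^+ q.1.
Proof.
move=> hadm inj; have /admissibleP[c1 c2 c3] := hadm.
have hf := twist_pairing (1 : {perm Box})%g.
apply: eq_big_unique.
- move=> S0 S0' /liftsP[_ e] /liftsP[_ e']; apply/permP=> x; apply: inj.
  by rewrite e e'.
- move=> [t S] [t' S'] /= /andP[/andP[ht hS] hs] /andP[/andP[ht' hS'] hs'].
  have o := emb_twist1 ht hS hs; have o' := emb_twist1 ht' hS' hs'.
  have /embP[_ a1 a2 a3] := hs; have /embP[_ b1 b2 b3] := hs'.
  have et : t = t'.
    apply: twist_inj; apply/permP=> y; case: (boolP (y \in codom s)) => [/codomP[x ->]|hy].
      by rewrite -a1 -b1.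
    by rewrite o // o'.
  congr (_, _) => //; apply/permP=> y; case: (boolP (y \in codom s)) => [/codomP[x ->]|hy].
    by rewrite -a2 -b2.
  by rewrite -a3 // -b3 // et.
- move=> S0 /liftsP[hS0 e].
  (* The image of [s] is stable under the colour swap, so $S_1$ and $S_2$ can be pushed forward and
     completed by that swap. *)
  have off y : y \notin codom s -> twist 1 y \notin codom s.
    by apply: contra => /codomP[x ex]; apply/codomP; exists (S0 x); rewrite e -ex pairingK.
  have [A' [hA' a1 a2]] := pairing_pushforward inj h1 hf off.
  have [S [hS b1 b2]] := pairing_pushforward inj h2 hf off.
  have hc y : (A' y).2 = ~~ y.2.
    case: (boolP (y \in codom s)) => [/codomP[x ->]|hy]; first by rewrite a1 c1.
    by rewrite a2 // twist1E.
  have [t et] := twist_of_pairing hA' hc; subst A'.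
  exists (t, S) => /=; apply/andP; split; [apply/andP; split|].
  + apply/colstabP=> b; have -> : t b = (twist t (b, true)).1 by rewrite twistE.
    case: (boolP ((b, true) \in codom s)) => [/codomP[x ex]|hy].
      by rewrite ex a1 c2 -ex.
    by rewrite a2 // twist1E.
  + apply/rowpairP; split=> // y.
    case: (boolP (y \in codom s)) => [/codomP[x ->]|hy]; first by rewrite b1 c3.
    by rewrite b2 // twist1E.
  + by apply/embP; split=> // y hy; rewrite a2 // b2.
- move=> [t S] /= /andP[/andP[ht hS] hs].
  have o := emb_twist1 ht hS hs; have /embP[_ a1 a2 a3] := hs.
  have hin x : twist 1 (s x) \in codom s.
    (* If the swapped box were off the image, [twist t] would swap it back to [s x]; it would then
       equal [s (S1 x)], which lies in the image. *)
    apply/negPn/negP=> h; have := o _ h; rewrite [RHS](pairingK hf) => e.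
    have e' : twist 1 (s x) = s (S1 x).
      by rewrite a1 -[in RHS]e (pairingK (twist_pairing t)).
    by rewrite e' codom_f in h.
  have [S0 [hS0 e]] := pairing_pullback inj hf hin.
  by exists S0; apply/liftsP.
- move=> S0 [t S] /liftsP[hS0 e] /= /andP[/andP[ht hS] hs].
  have o := emb_twist1 ht hS hs; have /embP[_ a1 a2 a3] := hs.
  have p1 z : (s (S1 z)).2 = ~~ (s z).2 by rewrite c1.
  have p0 z : (s (S0 z)).2 = ~~ (s z).2 by rewrite e twist_color.
  (* The red permutation of $(S_0,S_1)$ is carried by [s] to that of [twist 1] and [twist t], whose
     sign is that of [t]. *)
  have [p hp] := @red_perm_exists T S0 S1 (fun z => (s z).2) p0 p1.
  have [q hq] := @red_perm_exists _ (twist 1) (twist t) snd (@twist_color _ 1%g) (twist_color t).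
  rewrite /sg (sign_loops hS0 h1 p0 p1 hp hT) -(odd_perm_twist hq).
  rewrite -(odd_perm_transport inj (p := p) (q := q)) // => [x|y hy].
    by rewrite hq hp; case: ifP => // _; rewrite e a1.
  by rewrite hq; case: ifP => // _; rewrite o // pairingK.
Qed.

(** Non-injective fillings contribute to neither side: on the left their lifts cancel, on the right
    embeddings are injective. *)
Theorem sum_lifts :
  \sum_(s | admissible s) \sum_(S0 | lifts s S0) sg S0 =
  \sum_(t in colstab) \sum_(S in rowpair) (-1) ^+ t * #|emb S1 S2 (twist t) S|%:R.
Proof.
rewrite pair_big /=.
under [RHS]eq_bigr => q _ do rewrite -sum1_card natr_sum big_distrr /= mulr1.
rewrite [RHS](exchange_big_dep admissible) /=; last first.
  by move=> [t S] s /andP[ht hS] hs; exact: emb_admissible ht hS hs.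
apply: eq_bigr => s hs; case: (boolP (injectiveb s)) => [/injectiveP inj|ninj].
  by rewrite sum_lifts_injective.
rewrite sum_lifts_noninjective // big_pred0 // => -[t S] /=; apply/negP.
by case/andP=> _ /embP[/injectiveP inj]; rewrite inj in ninj.
Qed.

End MainSum.

(** * Young diagrams *)

Section Diagram.
Variable lam : seq nat.

Definition box := {b : 'I_(sumn lam) * 'I_(sumn lam) | in_diagram lam (b.1 : nat, b.2 : nat)}.
Definition box_row (b : box) : nat := (val b).1.
Definition box_col (b : box) : nat := (val b).2.

Lemma box_inj (b b' : box) : box_row b = box_row b' -> box_col b = box_col b' -> b = b'.
Proof.
rewrite /box_row /box_col => /val_inj e1 /val_inj e2; apply: val_inj.
by rewrite [LHS]surjective_pairing e1 e2 -surjective_pairing.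
Qed.

Hypothesis hlam : is_partition lam.

Lemma lam_geq i j : i <= j -> nth 0 lam j <= nth 0 lam i.
Proof.
move=> ij; case: (ltnP j (size lam)) => hj; last by rewrite nth_default.
case/andP: hlam => so _.
have tr : transitive geq by move=> x y z a b; apply: leq_trans b a.
by apply: (sorted_leq_nth tr (fun x => leqnn x) 0 so) => //; rewrite inE //; apply: leq_ltn_trans hj.
Qed.

Lemma size_lam : size lam <= sumn lam.
Proof.
have /andP[_] := hlam.
by elim: lam => //= a s IH /andP[a0 /IH]; lia.
Qed.

Lemma nth_lam_le i : nth 0 lam i <= sumn lam.
Proof.
elim: lam i => [|a s IH] [|i] //=; rewrite ?leq_addr //.
exact: leq_trans (IH i) (leq_addl _ _).
Qed.

Lemma sumn_take s j : sumn (take j s) = \sum_(i < j) nth 0 s i.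
Proof.
elim: s j => [|a s IH] [|j] //=; rewrite ?big_ord0 //.
  by rewrite big1 // => i _; rewrite nth_nil.
by rewrite big_ord_recl /= IH.
Qed.

Lemma box_mk r c : c < nth 0 lam r -> exists b : box, box_row b = r /\ box_col b = c.
Proof.
move=> hc; have hr : r < size lam by rewrite ltnNge; apply/negP=> h; rewrite nth_default in hc.
have hr' := leq_trans hr size_lam; have hc' := leq_trans hc (nth_lam_le r).
have P : in_diagram lam (((Ordinal hr', Ordinal hc') : 'I_(sumn lam) * 'I_(sumn lam)).1 : nat,
    ((Ordinal hr', Ordinal hc') : 'I_(sumn lam) * 'I_(sumn lam)).2 : nat).
  by rewrite /in_diagram /= hr hc.
by exists (exist (fun b : 'I_(sumn lam) * 'I_(sumn lam) => in_diagram lam (b.1 : nat, b.2 : nat))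
  (Ordinal hr', Ordinal hc') P).
Qed.

Lemma box_in (b : box) : box_col b < nth 0 lam (box_row b).
Proof. by have /andP[] := valP b. Qed.

(** Prefix sums, and with them dominance, become cardinalities of sets of boxes. *)
Lemma card_boxes_above j : #|[set b : box | box_row b < j]| = sumn (take j lam).
Proof.
rewrite sumn_take; have -> : \sum_(i < j) nth 0 lam i = \sum_(i < j) #|[set c : 'I_(sumn lam) | c < nth 0 lam i]|.
  apply: eq_bigr => i _; rewrite -sum1dep_card.
  by rewrite -(big_ord_widen _ (fun=> 1) (nth_lam_le i)) sum_nat_const muln1 card_ord.
rewrite -sum1dep_card; under [RHS]eq_bigr => i _ do rewrite -sum1dep_card.
rewrite pair_big_dep /= !sum1dep_card.
set A := [set b : box | _]; set C := [set _ | _].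
pose f (b : box) : nat * 'I_(sumn lam) := (box_row b, (val b).2).
pose g (q : 'I_j * 'I_(sumn lam)) : nat * 'I_(sumn lam) := (q.1 : nat, q.2).
have fi : injective f by move=> b b' [e1 e2]; apply: box_inj => //; rewrite /box_col e2.
have gi : injective g by move=> [a b] [a' b'] [/val_inj-> ->].
rewrite !cardE -(size_map f) -(size_map g); apply/eqP.
rewrite -uniq_size_uniq ?map_inj_uniq ?enum_uniq // => q.
apply/mapP/mapP => -[].
  move=> [a c]; rewrite mem_enum inE /= => hc ->.
  have [b [hb1 hb2]] := box_mk hc; exists b; rewrite /g /f /= ?hb1.
    by rewrite mem_enum inE hb1.
  by congr (_, _); apply: val_inj; rewrite /= -hb2.
move=> b; rewrite mem_enum inE => hb ->; exists (Ordinal hb, (val b).2) => //.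
by rewrite mem_enum inE /=; exact: box_in.
Qed.

Lemma card_box : #|{: box}| = sumn lam.
Proof.
have e := card_boxes_above (size lam); rewrite take_size in e.
transitivity #|[set b : box | box_row b < size lam]|; last exact: e.
apply/esym/eq_card => b; rewrite !inE.
by have /andP[] := valP b.
Qed.

Lemma card_boxb : #|{: box * bool}| = (sumn lam).*2.
Proof. by rewrite card_prod card_box card_bool muln2. Qed.

End Diagram.

Definition theta_pairs (rho lam : seq nat) : rat :=
  (\sum_(t in colstab (@box_col lam)) \sum_(S in rowpair (@box_row lam))
    if gtype (twist t) S == rho then (-1) ^+ t else 0)%R.

(** * Oriented pair-partitions as coloured fillings *)

Section PoSum.
Variables (k : nat) (S1 S2 : {perm 'I_(2 * k)}) (lam : seq nat).
Local Notation T := 'I_(2 * k).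
Hypotheses (h1 : pairing S1) (h2 : pairing S2).

Lemma card_T : #|{: T}| = k.*2. Proof. by rewrite card_ord mul2n. Qed.

Lemma N1_box (S0 : {perm T}) : N1 S0 S1 S2 lam =
  #|[set f : {ffun T -> box lam} | [forall l, [&& f l == f (S0 l),
       box_col (f l) == box_col (f (S1 l)) & box_row (f l) == box_row (f (S2 l))]]]|.
Proof.
rewrite /N1; set A := [set f | _]; set C := [set f | _].
pose h (f : {ffun T -> box lam}) := [ffun l => val (f l)].
have hi : injective h.
  by move=> f g /ffunP e; apply/ffunP=> l; apply: val_inj; have := e l; rewrite !ffunE.
rewrite -(card_imset C hi); congr #|pred_of_set _|; apply/setP=> f; apply/idP/imsetP.
  rewrite inE => /forallP hf.
  have [g hg] : exists g : T -> box lam, forall l, val (g l) = f l.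
    apply: (@fin_all_exists _ (fun=> box lam) (fun l b => val b = f l)) => l.
    by case/and4P: (hf l) => d _ _ _; exists (exist _ (f l) d).
  exists (finfun g); last by apply/ffunP=> l; rewrite !ffunE hg.
  rewrite inE; apply/forallP=> l; rewrite !ffunE /box_col /box_row !hg.
  by case/and4P: (hf l) => _ /eqP e e1 e2; rewrite -val_eqE /= !hg -e eqxx (eqP e1) (eqP e2) !eqxx.
case=> g; rewrite inE => /forallP hg ->; rewrite inE; apply/forallP=> l; rewrite !ffunE.
case/and3P: (hg l) => /eqP <- e1 e2; rewrite eqxx /=.
by apply/and3P; split=> //; exact: valP (g l).
Qed.

Local Open Scope ring_scope.

Lemma sum_Po_lifts :
  \sum_(x in Po_set S1) loop_sign x.1 S1 * (N1 x.1 S1 S2 lam)%:R =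
  \sum_(s | admissible S1 S2 (@box_row lam) (@box_col lam) s)
    \sum_(S0 | lifts s S0) (-1) ^+ (k - #|gloops S0 S1|).
Proof.
under eq_bigr => x _ do rewrite N1_box -sum1dep_card natr_sum big_distrr /= mulr1.
rewrite !pair_big_dep /=.
pose h (q : {ffun T -> box lam * bool} * {perm T}) : Po k * {ffun T -> box lam} :=
  ((q.2, [ffun i => (q.1 i).2]), [ffun i => (q.1 i).1]).
pose g (q : Po k * {ffun T -> box lam}) := ([ffun i => (q.2 i, q.1.2 i)], q.1.1).
have hg : cancel h g.
  move=> [s S0]; congr (_, _); apply/ffunP=> i; rewrite !ffunE.
  by rewrite -surjective_pairing.
have gh : cancel g h.
  by move=> [[S0 p] f]; congr (_, _, _); apply/ffunP=> i; rewrite !ffunE.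
rewrite (reindex h) /=; last by apply: onW_bij; exists g.
apply: eq_bigl => -[s S0] /=; apply/andP/andP.
  case; rewrite inE /= => /andP[hS0 /forallP c] /forallP d.
  have c1 i : (s (S0 i)).2 = ~~ (s i).2.
    by case/andP: (c i) => + _; rewrite !ffunE; case: (s _).2 (s _).2 => [] [].
  have c2 i : (s (S1 i)).2 = ~~ (s i).2.
    by case/andP: (c i) => _; rewrite !ffunE; case: (s _).2 (s _).2 => [] [].
  split.
    apply/admissibleP; split=> // i; case/and3P: (d i); rewrite !ffunE.
      by move=> _ /eqP.
    by move=> _ _ /eqP.
  apply/liftsP; split=> // i; rewrite twist1E [LHS]surjective_pairing c1.
  by case/and3P: (d i); rewrite !ffunE => /eqP <-.
case=> /admissibleP[c2 c3 c4] /liftsP[hS0 e]; split.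
  rewrite inE /=; apply/andP; split=> //; apply/forallP=> i; rewrite !ffunE e twist_color c2.
  by case: (s i).2.
by apply/forallP=> i; rewrite !ffunE e twist1E eqxx c3 c4 !eqxx.
Qed.

Lemma sort_cat_ones mu d : is_partition mu -> sort geq (mu ++ nseq d 1%N) = (mu ++ nseq d 1%N)%SEQ.
Proof.
have tr : transitive geq by move=> x y z a b; apply: leq_trans b a.
case/andP=> so po; apply: sorted_sort => //; rewrite sorted_pairwise // pairwise_cat.
rewrite -sorted_pairwise // so /=; apply/andP; split; last first.
  by elim: d => //= d IH; rewrite IH andbT; apply/allP=> x /nseqP[->].
by apply/allrelP=> x y hx /nseqP[-> _]; exact: (allP po).
Qed.

Theorem sum_Po mu : is_partition lam -> gtype S1 S2 = mu ->
  \sum_(x in Po_set S1) loop_sign x.1 S1 * (N1 x.1 S1 S2 lam)%:R =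
  if (k <= sumn lam)%N
  then (match_weight mu (sumn lam - k))%:R * theta_pairs (mu ++ nseq (sumn lam - k) 1%N) lam
  else 0.
Proof.
move=> hlam hmu; have cT := card_T; have cX := card_boxb hlam.
rewrite sum_Po_lifts (sum_lifts cT h1 h2 (@box_inj lam)).
have pmu : is_partition mu by rewrite -hmu gtype_partition.
(* With fewer than $k$ boxes there is no injection of $2k$ elements into the coloured boxes,
   matching the convention $\Sigma^{(2)}_\mu(\lambda)=0$. *)
case: leqP => hk; last first.
  rewrite big1 // => t _; rewrite big1 // => S _.
  rewrite (_ : emb _ _ _ _ = set0) ?cards0 ?mulr0 //; apply/setP=> s; rewrite in_set0; apply/negP.
  case/embP=> inj _ _ _; have := leq_card _ inj; rewrite cT cX; lia.
rewrite /theta_pairs mulr_sumr; apply: eq_bigr => t _; rewrite mulr_sumr; apply: eq_bigr => S.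
case/rowpairP=> hS _.
have hd : #|{: box lam * bool}| = (#|{: T}| + (sumn lam - k).*2)%N by rewrite cT cX; lia.
rewrite (card_emb h1 h2 (twist_pairing t) hS hd) hmu sort_cat_ones //.
by case: ifP; rewrite ?mulr0 // mulrC.
Qed.

End PoSum.

(** * The group [G] acts freely *)

Section Orbits.
Variables (k : nat) (S1 S2 : {perm 'I_(2 * k)}) (start : {set 'I_(2 * k)} -> 'I_(2 * k)).
Local Notation T := 'I_(2 * k).
Hypotheses (h1 : pairing S1) (h2 : pairing S2).
Hypothesis hstart : forall L, L \in gloops S1 S2 -> start L \in L.
Local Notation lp := (loop S1 S2).

(** All the $r_i$ at once: with positions counted from 0, a loop of length $N$ is reflected by
    $t\mapsto N-1-t$. *)
Definition mirror (y : T) := rfun S1 S2 start (lp y) y.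

Lemma jseq_walk x t : jseq S1 S2 x t = walk S1 S2 x t.
Proof. by elim: t => //= t ->. Qed.

Lemma loop_start x : lp (start (lp x)) = lp x.
Proof. by apply/eqP; rewrite loop_eqP // hstart // loop_in. Qed.

Lemma walk_start x : exists2 t, t < #|lp x| & x = walk S1 S2 (start (lp x)) t.
Proof.
have /(loopP h1 h2)[t e] : x \in lp (start (lp x)) by rewrite loop_start loop_refl.
exists (t %% #|lp x|); first by rewrite ltn_mod loop_gt0.
by have := walk_mod h1 h2 (start (lp x)) t; rewrite loop_start => ->.
Qed.

Lemma rfun_walk x t : t < #|lp x| ->
  rfun S1 S2 start (lp x) (walk S1 S2 (start (lp x)) t) = walk S1 S2 (start (lp x)) (#|lp x| - t.+1).
Proof.
move=> ht; have hin : walk S1 S2 (start (lp x)) t \in lp x.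
  by have := loop_mem_walk h1 h2 (start (lp x)) t; rewrite loop_start.
rewrite /rfun hin.
set s := [seq _ | _ <- _]; have ss : size s = #|lp x| by rewrite size_map size_iota.
have ns i : i < #|lp x| -> nth (walk S1 S2 (start (lp x)) t) s i = walk S1 S2 (start (lp x)) i.
  by move=> hi; rewrite (nth_map 0) ?size_iota // nth_iota // jseq_walk.
have us : uniq s.
  rewrite map_inj_in_uniq ?iota_uniq // => i j; rewrite !mem_iota !add0n => /andP[_ hi] /andP[_ hj].
  rewrite !jseq_walk => /eqP; rewrite walk_eq // loop_start !modn_small // => /eqP //.
rewrite -{2}(ns t ht) index_uniq ?ss // ns //; lia.
Qed.

Lemma mirror_walk x t : t < #|lp x| ->
  mirror (walk S1 S2 (start (lp x)) t) = walk S1 S2 (start (lp x)) (#|lp x| - t.+1).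
Proof.
move=> ht; rewrite /mirror; have -> : lp (walk S1 S2 (start (lp x)) t) = lp x.
  by apply/eqP; rewrite loop_eqP // -{2}(loop_start x) loop_mem_walk.
exact: rfun_walk.
Qed.

Lemma mirror_loop x : lp (mirror x) = lp x.
Proof.
have [t ht e] := walk_start x; rewrite {1}e mirror_walk //.
by apply/eqP; rewrite loop_eqP // -{3}(loop_start x) loop_mem_walk.
Qed.

Lemma mirrorK : involutive mirror.
Proof.
move=> x; have [t ht e] := walk_start x; rewrite {1}e mirror_walk // mirror_walk; last by lia.
by rewrite [RHS]e; congr walk; lia.
Qed.

(** $S_2$ joins positions $2i$ and $2i+1$; as $N$ is even, the reflection sends such a pair to
    another one. *)
Lemma mirrorS2 x : mirror (S2 x) = S2 (mirror x).
Proof.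
have [t ht e] := walk_start x; have hN := odd_loop h1 h2 x.
rewrite {1 2}e mirror_walk // !(walkB S1 h2).
case: ifP => ot; case: ifP => ot'; try by [move: ot ot' hN ht; lia].
- by rewrite mirror_walk; [congr walk; move: ot; lia | lia].
- by rewrite mirror_walk; [congr walk; lia | move: ot hN ht; lia].
Qed.

Lemma S1_start x : S1 (start (lp x)) = walk S1 S2 (start (lp x)) #|lp x|.-1.
Proof.
apply: (@perm_inj _ S1); rewrite pairingK // walkA //.
  have hN := odd_loop h1 h2 x; have N0 := loop_gt0 S1 S2 x.
  have -> : odd #|lp x|.-1 by lia.
  by rewrite prednK // -[#|lp x|]add0n -{3}(loop_start x) walk_addn.
have hN := odd_loop h1 h2 x; have N0 := loop_gt0 S1 S2 x; lia.
Qed.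

Lemma mirror_start x : mirror (start (lp x)) = S1 (start (lp x)).
Proof.
by have := @mirror_walk x 0 (loop_gt0 S1 S2 x); rewrite /= S1_start subn1.
Qed.

Lemma mirrorS1 x : mirror (S1 x) = S1 (mirror x).
Proof.
have [t ht e] := walk_start x; have hN := odd_loop h1 h2 x; have N0 := loop_gt0 S1 S2 x.
have last : S1 (walk S1 S2 (start (lp x)) #|lp x|.-1) = start (lp x) by rewrite -S1_start pairingK.
(* Positions 0 and $N-1$ form the closing $S_1$-pair and are exchanged by the reflection; they are
   treated apart because of the wrap-around. *)
rewrite {1 2}e; case: (posnP t) => [->|t0].
  by rewrite /= -mirror_start mirrorK mirror_start pairingK.
rewrite mirror_walk // walkA //; case: (eqVneq t #|lp x|.-1) => [->|nt].
  have -> : odd #|lp x|.-1 by lia.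
  rewrite prednK // subnn /= -[X in walk _ _ _ X]add0n -{2}(loop_start x) walk_addn //.
  exact: mirror_start.
have h : #|lp x| - t.+1 > 0 by lia.
rewrite walkA // mirror_walk; last by case: ifP; lia.
by congr walk; case: ifP => o1; case: ifP => o2; move: o1 o2; lia.
Qed.

(** Sets of loops index the elements of $G$, with symmetric difference as multiplication. *)
Definition flip_loops (I : {set {set T}}) y := if lp y \in I then mirror y else y.

Lemma flip_loopsK I : involutive (flip_loops I).
Proof.
move=> y; rewrite {2}/flip_loops; case: ifP => h; last by rewrite /flip_loops h.
by rewrite /flip_loops mirror_loop h mirrorK.
Qed.

Definition flipp I : {perm T} := perm (inv_inj (@flip_loopsK I)).

Lemma flippE I y : flipp I y = if lp y \in I then mirror y else y.
Proof. by rewrite permE. Qed.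

Lemma flippK I y : flipp I (flipp I y) = y.
Proof. by rewrite !permE flip_loopsK. Qed.

Lemma flippV I : (flipp I)^-1%g = flipp I.
Proof. by apply/permP=> y; apply: (@perm_inj _ (flipp I)); rewrite permKV flippK. Qed.

Lemma loop_flipp I y : lp (flipp I y) = lp y.
Proof. by rewrite flippE; case: ifP => _ //; rewrite mirror_loop. Qed.

Lemma flippM I J : (flipp I * flipp J)%g = flipp ((I :\: J) :|: (J :\: I)).
Proof.
apply/permP=> y; rewrite permM flippE loop_flipp !flippE !inE.
by case: (_ \in I); case: (_ \in J) => //=; rewrite mirrorK.
Qed.

Lemma flipp_commS1 I y : flipp I (S1 y) = S1 (flipp I y).
Proof. by rewrite !flippE loop_A // mirrorS1; case: ifP. Qed.

Lemma flipp_commS2 I y : flipp I (S2 y) = S2 (flipp I y).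
Proof. by rewrite !flippE loop_B // mirrorS2; case: ifP. Qed.

Lemma flipp_start I L : L \in gloops S1 S2 ->
  flipp I (start L) = if L \in I then S1 (start L) else start L.
Proof. by case/imsetP=> x _ ->; rewrite flippE loop_start mirror_start. Qed.

Lemma GgensE : Ggens S1 S2 start = [set flipp [set L] | L in gloops S1 S2].
Proof.
apply/setP=> s; rewrite inE; apply/exists_inP/imsetP => -[L hL].
  move=> /forallP h; exists L => //; apply/permP=> y; rewrite (eqP (h y)) flippE inE.
  case/imsetP: hL => x _ ->; rewrite loop_eqP // /mirror.
  case: ifP => hy; last by rewrite /rfun hy.
  by move: hy; rewrite -(loop_eqP h1 h2) => /eqP ->.
move=> ->; exists L => //; apply/forallP=> y; apply/eqP; rewrite flippE inE.
case/imsetP: hL => x _ ->; rewrite loop_eqP // /mirror.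
case: ifP => hy; last by rewrite /rfun hy.
by move: hy; rewrite -(loop_eqP h1 h2) => /eqP ->.
Qed.

Lemma GgroupE : Ggroup S1 S2 start = flipp @: powerset (gloops S1 S2).
Proof.
have f0 : flipp set0 = 1%g by apply/permP=> y; rewrite flippE inE perm1.
apply/eqP; rewrite eqEsubset; apply/andP; split.
  have gR : group_set (flipp @: powerset (gloops S1 S2)).
    apply/group_setP; split; first by rewrite -f0 imset_f // powersetE sub0set.
    move=> _ _ /imsetP[I + ->] /imsetP[J + ->]; rewrite !powersetE => hI hJ.
    by rewrite flippM imset_f // powersetE subUset !subDset !subsetU ?hI ?hJ ?orbT.
  rewrite -[_ @: _]/(gval (Group gR)) gen_subG GgensE; apply/subsetP=> s /imsetP[L hL ->].
  by rewrite imset_f // powersetE sub1set.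
apply/subsetP=> _ /imsetP[I + ->]; rewrite powersetE; have [n] := ubnP #|I|.
elim: n I => // n IH I hn hI; case: (set_0Vmem I) => [->|[L LI]]; first by rewrite f0 group1.
have -> : flipp I = (flipp [set L] * flipp (I :\ L))%g.
  rewrite flippM; congr flipp; apply/setP=> M; rewrite !inE.
  by case: (eqVneq M L) => [->|] //=; rewrite ?LI ?andbF //= ?orbF.
apply: groupM; first by apply: mem_gen; rewrite GgensE; apply/imsetP; exists L; rewrite ?(subsetP hI).
apply: IH; last exact: subset_trans (subsetDl _ _) hI.
by rewrite (cardsD1 L) LI in hn.
Qed.

Lemma actPoM g h x : actPo h (actPo g x) = @actPo k (g * h)%g x.
Proof.
rewrite /actPo /= conjgM; congr (_, _); apply/ffunP=> y; rewrite !ffunE.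
by rewrite invMg permM.
Qed.

Lemma actPo1 x : @actPo k 1%g x = x.
Proof.
case: x => S0 p; rewrite /actPo conjg1 /=; congr (_, _); apply/ffunP=> y.
by rewrite ffunE invg1 perm1.
Qed.

Lemma Po_setP (x : Po k) : reflect [/\ pairing x.1, forall i, x.2 (x.1 i) = ~~ x.2 i
     & forall i, x.2 (S1 i) = ~~ x.2 i] (x \in Po_set S1).
Proof.
rewrite inE; apply: (iffP andP).
  case=> hp /forallP h; split=> // i; case/andP: (h i).
    by case: (x.2 _) (x.2 _) => [] [].
  by move=> _; case: (x.2 _) (x.2 _) => [] [].
case=> hp a b; split=> //; apply/forallP=> i; rewrite a b.
by case: (x.2 i).
Qed.

Lemma conjg_pairing (g S0 : {perm T}) : pairing S0 -> pairing (S0 ^ g)%g.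
Proof.
move=> hS; have E z : (S0 ^ g)%g z = g (S0 (g^-1%g z)) by rewrite conjgE !permM.
apply/pairingP; split=> z; rewrite !E; first by rewrite permK pairingK // permKV.
by rewrite -{2}(permKV g z) (inj_eq perm_inj) pairing_neq.
Qed.

Lemma actPo_stable I x : x \in Po_set S1 -> actPo (flipp I) x \in Po_set S1.
Proof.
case/Po_setP=> hp a b; apply/Po_setP; rewrite /actPo /= flippV; split=> [|i|i].
- exact: conjg_pairing.
- by rewrite !ffunE conjgE !permM flippV flippK a.
- by rewrite !ffunE flipp_commS1 b.
Qed.

(** The orientation alone separates translates. For a loop [L] in [I] but not in [J], the reflection
    brings to [start L] the colour of its $S_1$-neighbour, which is the opposite one. *)
Lemma actPo_inj (x : Po k) (I J : {set {set T}}) : x \in Po_set S1 -> I \subset gloops S1 S2 -> J \subset gloops S1 S2 ->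
  actPo (flipp I) x = actPo (flipp J) x -> I = J.
Proof.
case/Po_setP=> hp a b.
suff key (I' J' : {set {set T}}) : I' \subset gloops S1 S2 ->
    actPo (flipp I') x = actPo (flipp J') x -> I' \subset J'.
  move=> hI hJ e; apply/eqP; rewrite eqEsubset; apply/andP.
  by split; [exact: key hI e | exact: key hJ (esym e)].
move=> hI e; apply/subsetP=> L LI; apply/negPn/negP=> LJ.
have hL := subsetP hI _ LI; have := congr1 (fun q : Po k => q.2 (start L)) e.
rewrite /actPo /= !ffunE !flippV !flipp_start // LI (negbTE LJ) b.
by case: (x.2 _).
Qed.

(** As [g] commutes with $S_1$, it maps the loops of $(S_0,S_1)$ onto those of the conjugated
    couple. *)
Lemma loop_sign_conj (S0 g : {perm T}) : pairing S0 -> (forall y, g (S1 y) = S1 (g y)) ->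
  loop_sign (S0 ^ g)%g S1 = loop_sign S0 S1.
Proof.
move=> hp c; have E z : g (S0 z) = (S0 ^ g)%g (g z) by rewrite conjgE !permM permK.
rewrite /loop_sign; congr (_ ^+ (_ - _))%R.
change (#|gloops (S0 ^ g)%g S1| = #|gloops S0 S1|).
rewrite -(card_imset (mem (gloops S0 S1)) (imset_inj (@perm_inj _ g))).
congr #|pred_of_set _|; apply/setP=> L; apply/imsetP/imsetP => -[x].
  move=> _ ->; exists (loop S0 S1 (g^-1%g x)); first exact: loop_in.
  by rewrite -{1}(permKV g x) (equiv_loop hp h1 (conjg_pairing g hp) h1 _ E c).
case/imsetP=> z _ -> ->; exists (g z) => //.
by rewrite (equiv_loop hp h1 (conjg_pairing g hp) h1 _ E c).
Qed.

Lemma N1_conj_le (S0 g : {perm T}) lam : (forall y, g (S1 y) = S1 (g y)) ->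
  (forall y, g (S2 y) = S2 (g y)) -> N1 S0 S1 S2 lam <= N1 (S0 ^ g)%g S1 S2 lam.
Proof.
move=> c1 c2; rewrite /N1; set A := [set f | _]; set C := [set f | _].
pose h (f : {ffun T -> 'I_(sumn lam) * 'I_(sumn lam)}) := [ffun l => f (g^-1%g l)].
have hi : injective h.
  move=> f f' e; apply/ffunP=> l; have := congr1 (fun q : {ffun _} => q (g l)) e.
  by rewrite !ffunE permK.
have inv (S : {perm T}) : (forall y, g (S y) = S (g y)) -> forall y, (g^-1)%g (S y) = S ((g^-1)%g y).
  by move=> c y; apply: (@perm_inj _ g); rewrite permKV c permKV.
rewrite -(card_imset A hi); apply: subset_leq_card; apply/subsetP=> _ /imsetP[f + ->].
rewrite !inE => /forallP hf; apply/forallP=> l; have := hf (g^-1%g l).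
by rewrite !ffunE conjgE !permM permK (inv _ c1) (inv _ c2).
Qed.

Lemma N1_conj (S0 g : {perm T}) lam : (forall y, g (S1 y) = S1 (g y)) ->
  (forall y, g (S2 y) = S2 (g y)) -> N1 (S0 ^ g)%g S1 S2 lam = N1 S0 S1 S2 lam.
Proof.
move=> c1 c2; apply/eqP; rewrite eqn_leq N1_conj_le // andbT.
have inv (S : {perm T}) : (forall y, g (S y) = S (g y)) -> forall y, (g^-1)%g (S y) = S ((g^-1)%g y).
  by move=> c y; apply: (@perm_inj _ g); rewrite permKV c permKV.
by have := N1_conj_le (S0 ^ g)%g lam (inv _ c1) (inv _ c2); rewrite conjgK.
Qed.

Theorem sum_orbits (F : Po k -> rat) (rep : {set Po k} -> Po k) :
  (forall O, O \in orbitsPo S1 S2 start -> rep O \in O) ->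
  (forall I x, x \in Po_set S1 -> F (actPo (flipp I) x) = F x) ->
  (\sum_(x in Po_set S1) F x =
   2 ^+ #|gloops S1 S2| * \sum_(O in orbitsPo S1 S2 start) F (rep O))%R.
Proof.
move=> hrep hF; pose orb x := [set actPo g x | g in Ggroup S1 S2 start].
have orbP y x : y \in orb x -> exists2 I : {set {set T}}, I \subset gloops S1 S2 & y = actPo (flipp I) x.
  case/imsetP=> g; rewrite GgroupE => /imsetP[I hI ->] ->; exists I => //.
  by rewrite -powersetE.
have orbE y x : y \in orb x -> orb y = orb x.
  case/imsetP=> g hg ->; apply/setP=> z; apply/imsetP/imsetP => -[h hh ->].
    by exists (g * h)%g; rewrite ?groupM // actPoM.
  by exists (g^-1 * h)%g; rewrite ?groupM ?groupV // actPoM mulKVg.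
have orb_refl x : x \in orb x by apply/imsetP; exists 1%g; rewrite ?group1 // actPo1.
rewrite (partition_big orb (fun O => O \in orbitsPo S1 S2 start)) /=; last first.
  by move=> x hx; apply: imset_f.
rewrite big_distrr /=; apply: eq_bigr => O hO; have [x hx eO] := imsetP hO.
have eO' : O = orb x by [].
have Fo y : y \in O -> F y = F (rep O).
  move=> hy; have h z : z \in O -> F z = F x.
    by rewrite eO' => /orbP[I _ ->]; apply: hF.
  by rewrite h // h // hrep.
rewrite (eq_bigl (mem O)) => [|y]; last first.
  apply/andP/idP => [[_ /eqP <-]|hy]; first exact: orb_refl.
  split; last by rewrite (orbE y x) -?eO'.
  by move: hy; rewrite /= eO' => /orbP[I _ ->]; apply: actPo_stable.
rewrite (eq_bigr (fun=> F (rep O))) //= sumr_const -[LHS]mulr_natl; congr (_ * _)%R.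
rewrite -natrX; congr (_%:R)%R; rewrite eO' /orb GgroupE -card_powerset -imset_comp.
apply: card_in_imset => I J; rewrite !powersetE => hI hJ /=; exact: actPo_inj.
Qed.

End Orbits.

(** * Power sums and alternating column sums *)

(** Expanding the product selects a variable, of index [g a], in each factor. *)
Lemma mcoeff_prod_psum (I : finType) n (w : I -> nat) (m : 'X_{1..n}) :
  ((\prod_a psum n (w a))@_m = #|[set g : {ffun I -> 'I_n} |
      [forall i, \sum_(a | g a == i) w a == m i]]|%:R)%R.
Proof.
rewrite /psum bigA_distr_bigA raddf_sum /= -sum1dep_card natr_sum [RHS]big_mkcond /=.
apply: eq_bigr => g _.
under eq_bigr => a _ do rewrite mpolyXn.
rewrite -(big_morph (fun q : 'X_{1..n} => 'X_[rat, q]%R) (@mpolyXD _ _) (@mpolyX0 _ _)) mcoeffX.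
have -> : ((\sum_a (U_(g a) *+ w a))%MM == m) = [forall i, \sum_(a | g a == i) w a == m i].
  apply/eqP/forallP => [<- i|h].
    rewrite mnm_sumE big_mkcond /=; apply/eqP; apply: eq_bigr => a _.
    by rewrite mulmnE mnm1E; case: eqP; rewrite ?mul1n.
  apply/mnmP=> i; rewrite -(eqP (h i)) mnm_sumE [RHS]big_mkcond /=; apply: eq_bigr => a _.
  by rewrite mulmnE mnm1E; case: eqP; rewrite ?mul1n.
by case: ifP.
Qed.

Lemma pprod_nth n (rho : seq nat) : Defs.pprod n rho = (\prod_(a < size rho) psum n (nth 0 rho a))%R.
Proof. by rewrite /Defs.pprod (big_nth 0) big_mkord. Qed.

(** One variable per loop is a labelling of the points constant on loops. A loop of $2\ell$ points
    contributes $\ell$ to an exponent, hence the doubling. *)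
Lemma mcoeff_pprod_gtype (T : finType) (A B : {perm T}) n (m : 'X_{1..n}) :
  pairing A -> pairing B ->
  ((Defs.pprod n (gtype A B))@_m = #|[set g : {ffun T -> 'I_n} |
     [forall x, (g (A x) == g x) && (g (B x) == g x)] &&
     [forall i, #|[set x | g x == i]| == (m i).*2]]|%:R)%R.
Proof.
move=> hA hB; have -> : Defs.pprod n (gtype A B) = (\prod_(L : {L | L \in gloops A B}) psum n (#|val L| %/ 2))%R.
  rewrite /Defs.pprod (perm_big _ (permEl (perm_sort _ _))) big_map big_enum /=.
  by rewrite (big_sub (mem (gloops A B)) (fun L => psum n (#|L| %/ 2))).
rewrite mcoeff_prod_psum; congr (_%:R)%R.
pose lp x : {L | L \in gloops A B} := exist _ (loop A B x) (loop_in A B x).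
have lp_surj L : exists x, L = lp x.
  by case: L => L hL; have /imsetP[x _ e] := hL; exists x; apply: val_inj.
have mem_lp x y : (x \in val (lp y)) = (lp x == lp y) by rewrite -val_eqE /= loop_eqP.
pose f (h : {ffun {L | L \in gloops A B} -> 'I_n}) := [ffun x => h (lp x)].
have fi : injective f.
  move=> h h' /ffunP e; apply/ffunP=> L; have [x ->] := lp_surj L.
  by have := e x; rewrite !ffunE.
rewrite -(card_imset _ fi); congr #|pred_of_set _|.
have fsum (h : {ffun {L | L \in gloops A B} -> 'I_n}) i :
    #|[set x | f h x == i]| = (\sum_(L | h L == i) (#|val L| %/ 2)).*2.
  rewrite -sum1dep_card (partition_big lp (fun L => h L == i)) /=; last first.
    by move=> x; rewrite ffunE.
  rewrite -mul2n big_distrr /=; apply: eq_bigr => L hL; have [y e] := lp_surj L.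
  rewrite mul2n e -[RHS](loop_half hA hB) sum1dep_card; apply: eq_card => x.
  rewrite inE ffunE; have -> : (x \in loop A B y) = (lp x == lp y) by exact: mem_lp.
  by case: (eqVneq (lp x) (lp y)) => [->|]; rewrite ?andbF // -e hL.
apply/setP=> g; apply/imsetP/idP.
  case=> h; rewrite inE => /forallP hh ->; rewrite inE; apply/andP; split.
    apply/forallP=> x; rewrite !ffunE; have -> : lp (A x) = lp x by apply: val_inj; exact: loop_A.
    by have -> : lp (B x) = lp x; [apply: val_inj; exact: loop_B | rewrite eqxx].
  by apply/forallP=> i; rewrite fsum (eqP (hh i)).
rewrite inE => /andP[/forallP inv /forallP cont].
have ginv x y : y \in loop A B x -> g y = g x.
  case/(loopP hA hB)=> t ->; elim: t => //= t <-.
  by case/andP: (inv (walk A B x t)) => /eqP ea /eqP eb; case: (odd t).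
have [h hh] : exists h : {L | L \in gloops A B} -> 'I_n,
    forall (L : {L | L \in gloops A B}) x, x \in val L -> h L = g x.
  apply: (@fin_all_exists _ (fun=> 'I_n) (fun (L : {L | L \in gloops A B}) v =>
    forall x, x \in val L -> v = g x)) => L.
  by have [y ->] := lp_surj L; exists (g y) => x /ginv.
have eg : g = f (finfun h).
  by apply/ffunP=> x; rewrite !ffunE (hh _ x) //= loop_refl.
exists (finfun h) => //; rewrite inE; apply/forallP=> i.
by have := cont i; rewrite {1}eg fsum => /eqP/double_inj ->.
Qed.

Lemma parts_mem n lam : (lam \in parts n) = is_partition lam && (sumn lam == n).
Proof.
rewrite /parts mem_filter -andbA; case: (boolP (is_partition lam)) => //= hp; case: eqP => //= hs.
rewrite mem_undup; apply/mapP; subst n.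
have hsz := size_lam hp; have hn := nth_lam_le lam.
(* The parts are padded with zeros to length $n$; the filter in [parts] removes the padding. *)
exists [tuple inord (nth 0 lam i) | i < sumn lam]; first by rewrite mem_enum.
rewrite /= -map_comp (eq_map (g := fun i : 'I_(sumn lam) => nth 0 lam i)); last first.
  by move=> i /=; rewrite inordK // ltnS.
rewrite (map_comp (nth 0 lam) val) val_enum_ord.
rewrite -(subnKC hsz) iotaD map_cat filter_cat.
have -> : [seq nth 0 lam i | i <- iota 0 (size lam)] = lam by rewrite map_nth_iota0 // take_size.
have -> : [seq x <- [seq nth 0 lam i | i <- iota (0 + size lam) (sumn lam - size lam)] | 0 < x] = [::].
  rewrite (@eq_in_filter _ _ pred0) ?filter_pred0 // => x /mapP[i].
  by rewrite mem_iota => /andP[hi _] ->; rewrite nth_default.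
by rewrite cats0; apply/esym/all_filterP; case/andP: hp.
Qed.

Lemma parts_uniq n : uniq (parts n).
Proof. by rewrite filter_uniq // undup_uniq. Qed.

Section Alternating.
Variables (lam : seq nat) (R : eqType) (g : box lam * bool -> R).
Local Notation colst := (colstab (@box_col lam)).

Definition col_inv (t : {perm box lam}) := [forall x, g (twist t x) == g x].

Lemma col_invP (t : {perm box lam}) : reflect (forall b, g (t b, false) = g (b, true)) (col_inv t).
Proof.
apply: (iffP forallP) => [h b|h [b []]]; first by have := h (b, true); rewrite twistE => /eqP.
  by rewrite twistE /twist_fun /= h.
by rewrite twistE /twist_fun /= -h permKV.
Qed.

(* Otherwise composing with the transposition of two boxes of a column carrying the same
   red label is a sign-reversing involution. *)
Lemma alternating_col_distinct :
  (\sum_(t in colst | col_inv t) (-1) ^+ t != 0 :> rat)%R ->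
  exists t, [/\ t \in colst, col_inv t &
    forall b b', box_col b = box_col b' -> g (b, true) = g (b', true) -> b = b'].
Proof.
move=> nz; have [t /andP[ht it]|h0] := pickP [pred t | (t \in colst) && col_inv t]; last first.
  by case/eqP: nz; apply: big_pred0.
exists t; split=> // b b' hc hg; apply/eqP/negPn/negP=> nb; case/eqP: nz.
set v := (\sum_(_ in _ | _) _)%R; suff /eqP : (v = - v)%R.
  by rewrite -subr_eq0 opprK -mulr2n -mulr_natl mulf_eq0 => /orP[|/eqP].
pose p := tperm b b'; have pp : (p * p = 1)%g by rewrite /p tperm2.
have gp a : g (p a, true) = g (a, true) by rewrite /p; case: tpermP => // ->.
have cp a : box_col (p a) = box_col a by rewrite /p; case: tpermP => // ->.
have st u : (u \in colst) && col_inv u -> (p * u \in colst)%g && col_inv (p * u)%g.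
  case/andP=> /colstabP h1 /col_invP h2; apply/andP; split.
    by apply/colstabP=> a; rewrite permM h1 cp.
  by apply/col_invP=> a; rewrite permM h2 gp.
rewrite /v -sumrN [LHS](reindex_inj (mulgI p)) /=; apply: eq_big => u.
  by apply/idP/idP=> /st //; rewrite mulgA pp mul1g.
by rewrite odd_permM /p odd_tperm nb /= signrN.
Qed.

End Alternating.

(** Column by column: distinct labels leave at most $j$ of them below $j$, and at most as many as
    the column has boxes. The first $j$ rows attain the minimum of the two bounds in every
    column. *)
Lemma card_col_distinct (lam : seq nat) (u : box lam -> nat) j : is_partition lam ->
  (forall b b', box_col b = box_col b' -> u b = u b' -> b = b') ->
  #|[set b | u b < j]| <= sumn (take j lam).
Proof.
move=> hlam ud; rewrite -(card_boxes_above hlam) -!sum1dep_card.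
have hc (b : box lam) : box_col b < sumn lam by rewrite /box_col.
pose cl (b : box lam) := Ordinal (hc b).
rewrite (partition_big cl predT) //= [X in _ <= X](partition_big cl predT) //=.
apply: leq_sum => c _; rewrite !sum1dep_card.
have clE b : (cl b == c) = (box_col b == c) by rewrite -val_eqE.
have [ex|none] := boolP [exists b : box lam, (box_col b == c) && (j <= box_row b)]; last first.
  apply: subset_leq_card; apply/subsetP=> b; rewrite !inE => /andP[_ hb]; rewrite hb andbT ltnNge.
  by apply: contraNN none => h; apply/existsP; exists b; rewrite -clE hb.
case/existsP: ex => b0 /andP[/eqP e0 hj].
apply: (@leq_trans j).
  rewrite cardE -(size_map u) -[leqRHS](size_iota 0); apply: uniq_leq_size.
    rewrite map_inj_in_uniq ?enum_uniq // => b b'; rewrite !mem_enum !inE !clE.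
    by move=> /andP[_ /eqP e] /andP[_ /eqP e']; apply: ud; rewrite e e'.
  by move=> x /mapP[b]; rewrite mem_enum inE mem_iota => /andP[hb _] ->.
have [f hf] : exists f : 'I_j -> box lam, forall r, box_row (f r) = r /\ box_col (f r) = c.
  apply: (@fin_all_exists _ (fun=> box lam) (fun (r : 'I_j) (b : box lam) => box_row b = r /\ box_col b = c)) => r.
  apply: box_mk => //; apply: leq_trans (lam_geq hlam (leq_trans (ltnW (ltn_ord r)) hj)).
  by rewrite -e0; exact: box_in.
have fi : injective f by move=> r r' e; apply: val_inj; rewrite /= -(hf r).1 -(hf r').1 e.
rewrite -[leqLHS]card_ord -(card_imset predT fi); apply: subset_leq_card.
by apply/subsetP=> _ /imsetP[r _ ->]; rewrite inE clE !(hf r).1 (hf r).2 ltn_ord eqxx.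
Qed.

(** Green labels are red labels moved by a permutation [t], so both colours have equally many small
    labels and the bound for one colour doubles. *)
Theorem alternating_col_dominates (lam : seq nat) (g : box lam * bool -> nat) j :
  is_partition lam ->
  (\sum_(t in colstab (@box_col lam) | col_inv g t) (-1) ^+ t != 0 :> rat)%R ->
  #|[set x | g x < j]| <= (sumn (take j lam)).*2.
Proof.
move=> hlam nz; have [t [_ /col_invP gt gd]] := alternating_col_distinct nz.
have e1 : #|[set b | g (b, false) < j]| = #|[set b | g (b, true) < j]|.
  rewrite -[RHS](card_imset _ (@perm_inj _ t)); apply/eq_card=> b; rewrite inE.
  apply/idP/imsetP => [h|[b']]; last by rewrite inE => h ->; rewrite gt.
  by exists ((t^-1)%g b); rewrite ?permKV // inE -gt permKV.
have -> : #|[set x | g x < j]| = #|[set b | g (b, true) < j]| + #|[set b | g (b, false) < j]|.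
  rewrite -!sum1dep_card ![\sum_(_ | _) _]big_mkcond /= -big_split /=.
  rewrite (eq_bigr (fun x => if g (x.1, x.2) < j then 1 else 0)) => [|[] //].
  rewrite -(pair_bigA _ (fun b c => if g (b, c) < j then 1 else 0)) /=.
  by apply: eq_bigr => b _; rewrite big_bool.
by rewrite e1 addnn leq_double; exact: card_col_distinct.
Qed.

Lemma sumn_take_label n (mu : seq nat) (X : finType) (g : X -> 'I_n) j : size mu <= n ->
  (forall i, #|[set x | g x == i]| = (nth 0 mu i).*2) ->
  #|[set x | g x < j]| = (sumn (take j mu)).*2.
Proof.
move=> hsz hc; rewrite -sum1dep_card (partition_big g (fun i : 'I_n => i < j)) //=.
have -> : sumn (take j mu) = \sum_(i < n | i < j) nth 0 mu i.
  rewrite sumn_take; case: (leqP j n) => hj; first by rewrite (big_ord_widen _ (nth 0 mu) hj).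
  rewrite [RHS](eq_bigl predT) => [|i]; last by rewrite (ltn_trans _ hj).
  rewrite (big_ord_widen _ (nth 0 mu) (ltnW hj)) [LHS](bigID (fun i : 'I_j => i < n)) /=.
  rewrite [X in _ + X]big1 ?addn0 // => i; rewrite -leqNgt => h.
  by rewrite nth_default // (leq_trans hsz).
rewrite -mul2n big_distrr /=; apply: eq_bigr => i hi; rewrite mul2n -hc sum1dep_card.
by apply: eq_card => x; rewrite !inE; case: eqP => [->|]; rewrite ?andbF // hi.
Qed.

Lemma prefix_sums_inj (a b : seq nat) : is_partition a -> is_partition b ->
  (forall j, sumn (take j a) = sumn (take j b)) -> a = b.
Proof.
case/andP=> _ pa /andP[_ pb]; elim: a b pa pb => [|x a IH] [|y b] //=.
- by move=> _ /andP[y0 _] /(_ 1); rewrite /= take0; lia.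
- by move=> /andP[x0 _] _ /(_ 1); rewrite /= take0; lia.
move=> /andP[_ pa] /andP[_ pb] h; have := h 1; rewrite /= !take0 !addn0 => e.
by rewrite e; congr (_ :: _); apply: IH => // j; have := h j.+1; rewrite /= e => /addnI.
Qed.

(** Beyond the range tested by [dominated] both prefix sums have reached the common total. *)
Lemma dominatedP mu lam : sumn mu = sumn lam ->
  reflect (forall j, sumn (take j mu) <= sumn (take j lam)) (dominated mu lam).
Proof.
move=> e; apply: (iffP forallP) => h j; last exact: h.
case: (ltnP j (size mu + size lam).+1) => hj; first exact: (h (Ordinal hj)).
by rewrite !take_oversize ?e //; lia.
Qed.

Lemma gtypeC (T : finType) (A B : {perm T}) : gtype A B = gtype B A.
Proof.
rewrite /gtype; have -> // : gloops A B = gloops B A.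
apply: eq_imset => x; apply/setP=> y; rewrite !inE.
by apply: eq_connect => a b /=; rewrite orbC.
Qed.

Lemma gtype_parts lam (A B : {perm box lam * bool}) : is_partition lam ->
  pairing A -> pairing B -> gtype A B \in parts (sumn lam).
Proof.
move=> hlam hA hB; rewrite parts_mem gtype_partition //=.
by apply/eqP/double_inj; rewrite sumn_gtype // card_boxb.
Qed.

(** * Uniqueness of triangular orthogonal families *)

Section TriangularOrthogonal.
Import Order.TTheory Num.Theory.
Local Open Scope ring_scope.
(** Intended reading: [K] holds partitions, vectors are given in power-sum coordinates, [x r m] is
    the coefficient of the monomial [m] in $p_r$, [w] is the weight of the scalar product, [ht]
    increases along dominance, [sz] is the number of parts, and [e] is $1^n$. *)
Variables (F : realFieldType) (K : eqType) (P : seq K) (x : K -> K -> F) (w : K -> F).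
Variables (ht sz : K -> nat) (e : K).
Hypotheses (uP : uniq P) (eP : e \in P) (w_gt0 : forall r, r \in P -> 0 < w r).
Hypothesis x_diag : forall r, r \in P -> x r r != 0.
Hypothesis x_tri : forall r m, r \in P -> m \in P -> x r m != 0 -> r = m \/ (sz m < sz r)%N.

Definition coefs (f : K -> F) m := \sum_(r <- P) f r * x r m.
Definition pairing_form (f g : K -> F) := \sum_(r <- P) f r * g r * w r.

(** The system is triangular in [sz] and is solved from the largest [sz] downwards; the sum of all
    sizes merely bounds the descending induction. *)
Lemma coefs_eq0 f : (forall m, m \in P -> coefs f m = 0) -> forall r, r \in P -> f r = 0.
Proof.
move=> h r; have [b] := ubnP (\sum_(q <- P) sz q - sz r).
elim: b r => // b IH r hb rP.
have := h r rP; rewrite /coefs (bigD1_seq r) //= big1_seq ?addr0 => [/eqP|q /andP[nq qP]].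
  by rewrite mulf_eq0 (negbTE (x_diag rP)) orbF => /eqP.
case: (eqVneq (x q r) 0) => [->|/(x_tri qP rP)[eq|lt]]; first by rewrite mulr0.
  by rewrite eq eqxx in nq.
rewrite IH ?mul0r //.
have : (sz q <= \sum_(q <- P) sz q)%N by rewrite (bigD1_seq q) //= leq_addr.
by move: hb lt; lia.
Qed.

Lemma form_eq0 f : pairing_form f f = 0 -> forall r, r \in P -> f r = 0.
Proof.
move=> h r rP; have h0 q : q \in P -> 0 <= f q * f q * w q.
  by move=> qP; apply: mulr_ge0; [rewrite -expr2 sqr_ge0 | rewrite ltW ?w_gt0].
move: h; rewrite /pairing_form (bigD1_seq r) //= => /eqP.
rewrite paddr_eq0 ?h0 //; last first.
  by rewrite big_seq_cond sumr_ge0 // => q /andP[qP _]; exact: h0.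
by rewrite !mulf_eq0 (gt_eqF (w_gt0 rP)) orbF orbb => /andP[/eqP].
Qed.

Definition tri_family (V : K -> K -> F) :=
  forall l m, l \in P -> m \in P -> coefs (V l) m != 0 -> m = l \/ (ht m < ht l)%N.
Definition orth_family (V : K -> K -> F) :=
  forall l l', l \in P -> l' \in P -> l != l' -> pairing_form (V l) (V l') = 0.

Lemma coefsB f g c m : coefs (fun r => f r - c * g r) m = coefs f m - c * coefs g m.
Proof.
rewrite /coefs mulr_sumr -sumrB; apply: eq_bigr => r _.
by rewrite mulrBl mulrA.
Qed.

Lemma formB f g c k : pairing_form (fun r => f r - c * g r) k = pairing_form f k - c * pairing_form g k.
Proof.
rewrite /pairing_form mulr_sumr -sumrB; apply: eq_bigr => r _.
by rewrite mulrBl mulrBl !mulrA.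
Qed.

Variable W : K -> K -> F.
Hypotheses (triW : tri_family W) (orthW : orth_family W) (We : forall l, l \in P -> W l e = 1).

(** A form of completeness: below height [j], the [W l] leave no room for a nonzero vector
    orthogonal to all of them. *)
Let null j := forall f, (forall m, m \in P -> coefs f m != 0 -> (ht m < j)%N) ->
  (forall l, l \in P -> (ht l < j)%N -> pairing_form f (W l) = 0) -> forall r, r \in P -> f r = 0.

(** If its leading coefficient vanished, [W l] would be supported strictly below its height and
    orthogonal to every lower [W l'], hence zero, against the normalisation at [e]. *)
Lemma diag_of_null l : l \in P -> null (ht l) -> coefs (W l) l != 0.
Proof.
move=> lP hn; apply/negP=> /eqP c0; have := We lP; rewrite (hn (W l)) //.
- by move/eqP; rewrite eq_sym oner_eq0.
- move=> m mP nz; case: (triW lP mP nz) => // eq.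
  by rewrite eq c0 eqxx in nz.
- move=> l' lP' lt; apply: orthW => //; apply: contraTneq lt => ->.
  by rewrite ltnn.
Qed.

(* Gram-Schmidt: subtracting multiples of the [W l] of height [j] lowers the support. *)
Lemma null_all j : null j.
Proof.
elim: j => [|j IH] f hf hW.
  by apply: coefs_eq0 => m mP; apply/eqP/negPn/negP=> /(hf m mP).
pose a l := if ht l == j then coefs f l / coefs (W l) l else 0.
pose g r := f r - \sum_(l <- P) a l * W l r.
have diag l : l \in P -> ht l = j -> coefs (W l) l != 0.
  by move=> lP h; apply: diag_of_null => //; rewrite h.
have cg m : coefs g m = coefs f m - \sum_(l <- P) a l * coefs (W l) m.
  rewrite /coefs /g; under eq_bigr => r _ do rewrite mulrBl mulr_suml.
  rewrite sumrB exchange_big; congr (_ - _); apply: eq_bigr => l _.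
  by rewrite mulr_sumr; apply: eq_bigr => r _; rewrite mulrA.
have fg h : pairing_form g h = pairing_form f h - \sum_(l <- P) a l * pairing_form (W l) h.
  rewrite /pairing_form /g; under eq_bigr => r _ do rewrite mulrBl mulrBl !mulr_suml.
  rewrite sumrB exchange_big; congr (_ - _); apply: eq_bigr => l _.
  by rewrite mulr_sumr; apply: eq_bigr => r _; rewrite !mulrA.
have g0 : forall r, r \in P -> g r = 0.
  apply: IH => [m mP|l lP lt].
    rewrite cg; apply: contraNT; rewrite -leqNgt => hm.
    rewrite (bigD1_seq m) //= big1_seq ?addr0 => [|l /andP[nl lP]]; last first.
      rewrite /a; case: eqP => [hl|]; last by rewrite mul0r.
      case: (eqVneq (coefs (W l) m) 0) => [->|]; first by rewrite mulr0.
      by case/(triW lP mP) => [eq|]; [rewrite eq eqxx in nl | rewrite hl ltnNge hm].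
    rewrite /a; case: (eqVneq (ht m) j) => h; first by rewrite divfK ?subrr ?diag.
    rewrite mul0r subr0; apply: contraNT h => /(hf m mP); rewrite ltnS => h.
    by rewrite eqn_leq h hm.
  rewrite fg hW //; last exact: ltnW.
  rewrite big1_seq ?subr0 // => l' /andP[_ lP']; rewrite /a.
  case: eqP => [h|]; last by rewrite mul0r.
  by rewrite orthW ?mulr0 //; apply: contraTneq lt => <-; rewrite h ltnn.
(* Pairing the vanishing [g] with [W l] leaves [a l] times the norm of [W l], which is nonzero by
   positivity and the normalisation at [e]. *)
have a0 l : l \in P -> a l = 0.
  move=> lP; case: (eqVneq (ht l) j) => [h|h]; last by rewrite /a (negbTE h).
  have : pairing_form g (W l) = 0.
    by rewrite /pairing_form big1_seq // => r /andP[_ rP]; rewrite g0 // !mul0r.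
  rewrite fg hW ?h // (bigD1_seq l) //= big1_seq ?addr0 => [|l' /andP[nl lP']]; last first.
    by rewrite orthW ?mulr0.
  rewrite sub0r => /eqP; rewrite oppr_eq0 mulf_eq0 => /orP[/eqP //|/eqP /form_eq0/(_ e eP)].
  by rewrite We // => /eqP; rewrite oner_eq0.
move=> r rP; have := g0 r rP; rewrite /g big1_seq ?subr0 // => l /andP[_ lP].
by rewrite a0 ?mul0r.
Qed.

Variable Z : K -> K -> F.
Hypotheses (triZ : tri_family Z) (orthZ : orth_family Z) (Ze : forall l, l \in P -> Z l e = 1).

(** Induction on height: [c] cancels the leading coefficient of $Z_l-cW_l$, and the lower [W l']
    equal [Z l'], so this vector is orthogonal to them and vanishes. The normalisation at [e] then
    gives $c=1$. *)
Theorem triangular_orthogonal_uniq l r : l \in P -> r \in P -> Z l r = W l r.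
Proof.
have [b] := ubnP (ht l); elim: b l r => // b IH l r hb lP rP.
have d := diag_of_null lP (@null_all _).
set c := coefs (Z l) l / coefs (W l) l.
have key q : q \in P -> Z l q - c * W l q = 0.
  move: q; apply: (@null_all (ht l)) => [m mP|l' lP' lt].
    rewrite coefsB; apply: contraNT; rewrite -leqNgt => hm.
    case: (eqVneq m l) => [->|nm]; first by rewrite divfK ?subrr.
    have z V : tri_family V -> coefs (V l) m = 0.
      move=> tV; apply/eqP/negPn/negP=> /(tV _ _ lP mP)[eq|]; last by rewrite ltnNge hm.
      by rewrite eq eqxx in nm.
    by rewrite !z // mulr0 subr0.
  have nl : l != l' by apply: contraTneq lt => ->; rewrite ltnn.
  rewrite formB [pairing_form (W l) _]orthW // mulr0 subr0.
  rewrite -[RHS](orthZ lP lP' nl); apply: eq_big_seq => q qP.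
  by rewrite -(IH l' q) //; exact: leq_trans lt _.
have c1 : c = 1 by apply/eqP; have /eqP := key e eP; rewrite Ze // We // mulr1 subr_eq0 eq_sym.
by apply/eqP; rewrite -subr_eq0 -[W l r]mul1r -c1 key.
Qed.

End TriangularOrthogonal.

(** * The column-row sums are the zonal coefficients *)

Section PowerSumCoefficients.
Variable n : nat.

Definition power_coef (r m : seq nat) : rat := ((Defs.pprod n r)@_(mon n m))%R.

Lemma power_coefE r m : power_coef r m = (#|[set g : {ffun 'I_(size r) -> 'I_n} |
  [forall i, \sum_(a | g a == i) nth 0 r a == nth 0 m i]]|%:R)%R.
Proof.
rewrite /power_coef pprod_nth (mcoeff_prod_psum (fun a : 'I_(size r) => nth 0 r a)).
congr (_%:R)%R; apply: eq_card => g; rewrite !inE; apply: eq_forallb => i.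
by rewrite mnmE.
Qed.

Lemma parts_size m : m \in parts n -> size m <= n.
Proof. by rewrite parts_mem => /andP[h /eqP <-]; exact: size_lam. Qed.

Lemma parts_gt0 m i : m \in parts n -> i < size m -> 0 < nth 0 m i.
Proof.
rewrite parts_mem => /andP[/andP[_ /allP h] _] hi.
by apply: h; rewrite mem_nth.
Qed.

Lemma parts_perm_eq r m : r \in parts n -> m \in parts n -> perm_eq r m -> r = m.
Proof.
rewrite !parts_mem => /andP[/andP[sr _] _] /andP[/andP[sm _] _].
apply: (@sorted_eq _ geq) sr sm => //.
  by move=> x y z h1 h2; apply: leq_trans h2 h1.
by move=> x y; rewrite andbC; apply: anti_leq.
Qed.

Lemma power_coef_diag r : r \in parts n -> (power_coef r r != 0)%R.
Proof.
move=> hr; have hs := parts_size hr.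
rewrite power_coefE Num.Theory.pnatr_eq0 cards_eq0; apply/set0Pn.
exists [ffun a => widen_ord hs a]; rewrite inE; apply/forallP=> i.
case: (ltnP i (size r)) => hi.
  rewrite (bigD1 (Ordinal hi)) /= ?ffunE -?val_eqE //= big1 ?addr0 // => a.
  by rewrite ffunE -!val_eqE /= => /andP[->].
rewrite big_pred0 ?nth_default // => a; rewrite ffunE -val_eqE /=.
by apply/negP=> /eqP e; have := ltn_ord a; rewrite e ltnNge hi.
Qed.

(** The parts of [m] are sums of parts of [r] with a common label, so each uses at least one part of
    [r]; equal lengths make the labelling injective. *)
Lemma power_coef_tri r m : r \in parts n -> m \in parts n ->
  (power_coef r m != 0)%R -> r = m \/ size m < size r.
Proof.
move=> hr hm; rewrite power_coefE Num.Theory.pnatr_eq0 cards_eq0 => /set0Pn[g].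
rewrite inE => /forallP hg.
set s2 := [seq nat_of_ord (g a) | a <- enum 'I_(size r)].
have ss2 : size s2 = size r by rewrite size_map size_enum_ord.
have sub : {subset iota 0 (size m) <= s2}.
  move=> i; rewrite mem_iota add0n => /andP[_ hi].
  have hin := leq_trans hi (parts_size hm).
  case: (pickP [pred a | g a == Ordinal hin]) => [a /eqP ga|no].
    by apply/mapP; exists a; rewrite ?mem_enum // ga.
  have := hg (Ordinal hin); rewrite big_pred0 //= eq_sym => /eqP e.
  by have := parts_gt0 hm hi; rewrite e.
have le := uniq_leq_size (iota_uniq _ _) sub; rewrite size_iota ss2 in le.
move: le; rewrite leq_eqVlt => /predU1P[e|]; [left|by right].
have u2 : uniq s2 by apply: (leq_size_uniq (iota_uniq 0 (size m)) sub); rewrite size_iota ss2 e.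
have eqs : iota 0 (size m) =i s2.
  by have [] := uniq_min_size (iota_uniq 0 (size m)) sub _; rewrite ?size_iota ?ss2 ?e.
have gi : injective g.
  by move=> a b h; apply: (uniq_map_inj u2); rewrite ?mem_enum //= h.
apply: parts_perm_eq => //; rewrite perm_sym.
have em : [seq nth 0 m i | i <- iota 0 (size m)] = m by rewrite map_nth_iota0 // take_size.
have er : [seq nth 0 m i | i <- s2] = r.
  rewrite /s2 -map_comp -[RHS](@take_size _ r) -(@map_nth_iota0 _ 0) // -val_enum_ord -[RHS]map_comp.
  apply: eq_map => a /=; rewrite -(eqP (hg (g a))).
  by apply: big_pred1 => b /=; exact: inj_eq.
rewrite -{1}em -er; apply: perm_map; apply: uniq_perm => //; exact: iota_uniq.
Qed.

Lemma ones_parts : nseq n 1 \in parts n.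
Proof.
rewrite parts_mem sumn_nseq mul1n eqxx andbT; apply/andP; split.
  by elim: n => // -[|j] //= ->.
by apply/allP=> x /nseqP[->].
Qed.

(** Only $p_{1^n}$ contains the squarefree monomial $x_1\cdots x_n$. The normalisation by $n!$
    therefore says that the coordinate at $1^n$ is 1. *)
Lemma power_coef_ones r : r \in parts n ->
  power_coef r (nseq n 1) = (if r == nseq n 1 then (n`!)%:R else 0)%R.
Proof.
move=> hr; case: eqP => [->|ne]; last first.
  apply/eqP/negPn/negP=> /(power_coef_tri hr ones_parts)[//|].
  by rewrite size_nseq ltnNge parts_size.
rewrite power_coefE; congr (_%:R)%R; set l := size _.
have el : l = n by rewrite /l size_nseq.
have one i : i < n -> nth 0 (nseq n 1) i = 1 by move=> hi; rewrite nth_nseq hi.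
transitivity #|[set g : {ffun 'I_l -> 'I_n} | injectiveb g]|; last first.
  by rewrite card_inj_ffuns !card_ord el ffactnn.
apply: eq_card => g; rewrite !inE.
have fib i : \sum_(a < l | g a == i) nth 0 (nseq n 1) a = #|[set a | g a == i]|.
  rewrite -sum1dep_card; apply: eq_bigr => a _; apply: one.
  by rewrite -el.
apply/forallP/injectiveP => [h a b e|gi i].
  have := h (g a); rewrite fib one // => /cards1P[c /setP ec].
  have := ec a; have := ec b; rewrite !inE e eqxx => /esym/eqP -> /esym/eqP -> //.
rewrite fib one //; apply/cards1P.
have [f fK Kf] : bijective g by apply: inj_card_bij => //; rewrite !card_ord el.
exists (f i); apply/setP=> a; rewrite !inE.
by apply/eqP/eqP => [<-|->]; rewrite ?fK ?Kf.
Qed.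

Lemma coefs_Zpoly (theta : seq nat -> seq nat -> rat) lam m :
  ((Zpoly theta n lam)@_(mon n m) = coefs (parts n) power_coef (theta^~ lam) m)%R.
Proof.
rewrite /Zpoly raddf_sum; apply: eq_bigr => r _.
exact: mcoeffZ.
Qed.

End PowerSumCoefficients.

(** A numerical rank that strictly increases along strict dominance. *)
Definition prefix_height n (lam : seq nat) := \sum_(j < n.+1) sumn (take j lam).

Lemma dominated_height n mu lam : mu \in parts n -> lam \in parts n ->
  dominated mu lam -> mu = lam \/ prefix_height n mu < prefix_height n lam.
Proof.
move=> hmu hlam; have szm := parts_size hmu; have szl := parts_size hlam.
move: hmu hlam; rewrite !parts_mem => /andP[pm /eqP sm] /andP[pl /eqP sl].
move/(dominatedP (etrans sm (esym sl))) => dom.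
have := @leqif_sum _ predT (fun j : 'I_n.+1 => sumn (take j mu) == sumn (take j lam)) _ _ (fun j _ => leqif_eq (dom j)).
rewrite -/(prefix_height n mu) -/(prefix_height n lam) => -[le eq].
case: (ltnP (prefix_height n mu) (prefix_height n lam)) => [|ge]; [by right|left].
have : prefix_height n mu == prefix_height n lam by rewrite eqn_leq le.
rewrite eq => /forallP h; apply: prefix_sums_inj => // j.
case: (ltnP j n.+1) => hj; first by have := h (Ordinal hj) => /eqP.
by rewrite (take_oversize (leq_trans szm (ltnW hj))) (take_oversize (leq_trans szl (ltnW hj))) sm sl.
Qed.

Section ThetaPairs.
Local Open Scope ring_scope.

Lemma sum_theta_pairs lam (y : seq nat -> rat) : is_partition lam ->
  \sum_(r <- parts (sumn lam)) theta_pairs r lam * y r =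
  \sum_(t in colstab (@box_col lam)) \sum_(S in rowpair (@box_row lam))
    (-1) ^+ t * y (gtype (twist t) S).
Proof.
move=> hlam; rewrite /theta_pairs; under eq_bigr => r _ do rewrite mulr_suml.
rewrite exchange_big; apply: eq_bigr => t _ /=.
under eq_bigr => r _ do rewrite mulr_suml.
rewrite exchange_big; apply: eq_bigr => S /rowpairP[hS _] /=.
have hg := gtype_parts hlam (twist_pairing t) hS.
rewrite (bigD1_seq _ hg (parts_uniq _)) /= eqxx big1 ?addr0 // => r.
by rewrite eq_sym => /negbTE ->; rewrite mul0r.
Qed.

(** With [S] and an [S]-invariant labelling fixed, the sum over [t] is an alternating column sum; if
    it is nonzero, the labels below $j$ fit into the first $j$ rows, for every $j$. *)
Lemma theta_pairs_tri lam m : is_partition lam -> m \in parts (sumn lam) ->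
  coefs (parts (sumn lam)) (power_coef (sumn lam)) (theta_pairs^~ lam) m != 0 -> dominated m lam.
Proof.
move=> hlam hm; rewrite /coefs (sum_theta_pairs (power_coef (sumn lam) ^~ m)) //.
apply: contraR => ndom.
set n := sumn lam in hm *.
pose ok S (g : {ffun box lam * bool -> 'I_n}) :=
  [forall x, g (S x) == g x] && [forall i, #|[set x | g x == i]| == (nth 0%N m i).*2]%N.
have -> : \sum_(t in colstab (@box_col lam)) \sum_(S in rowpair (@box_row lam))
    (-1) ^+ t * power_coef n (gtype (twist t) S) m =
  \sum_(S in rowpair (@box_row lam)) \sum_(g | ok S g)
     \sum_(t in colstab (@box_col lam) | col_inv (fun x => nat_of_ord (g x)) t) (-1) ^+ t :> rat.
  rewrite exchange_big; apply: eq_bigr => S /rowpairP[hS _] /=.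
  rewrite [RHS](exchange_big_dep (mem (colstab (@box_col lam)))) /=; last first.
    by move=> g t _ /andP[].
  apply: eq_bigr => t ht; rewrite /power_coef mcoeff_pprod_gtype ?twist_pairing //.
  rewrite -sum1dep_card natr_sum big_distrr /=; apply: eq_big => g; last by rewrite mulr1.
  apply/andP/andP.
    case=> /forallP inv /forallP cont; split.
      apply/andP; split; first by apply/forallP=> x; case/andP: (inv x).
      by apply/forallP=> i; have := cont i; rewrite mnmE.
    apply/andP; split; [exact: ht | apply/forallP=> x].
    by case/andP: (inv x) => /eqP ->.
  case=> /andP[/forallP invS /forallP cont] /andP[_ /forallP invt]; split.
    by apply/forallP=> x; rewrite invS andbT -val_eqE; exact: invt.
  by apply/forallP=> i; have := cont i; rewrite mnmE.
apply/eqP; apply: big1 => S _; apply: big1 => g /andP[_ /forallP cont].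
apply/eqP; apply: contraR ndom => nz.
have hms : sumn m = sumn lam by move: hm; rewrite parts_mem => /andP[_ /eqP].
apply/(dominatedP hms) => j; rewrite -leq_double.
rewrite -(@sumn_take_label n m _ g j) ?(parts_size hm) //; last by move=> i; exact/eqP.
exact: alternating_col_dominates hlam nz.
Qed.

Lemma gtype_ones (T : finType) (A B : {perm T}) n : #|T| = n.*2 -> pairing A -> pairing B ->
  (gtype A B == nseq n 1%N) = [forall x, A x == B x].
Proof.
move=> hT hA hB.
have mem_gt x : (#|loop A B x| %/ 2)%N \in gtype A B.
  by rewrite mem_sort; apply: map_f; rewrite mem_enum loop_in.
apply/eqP/forallP => [e x|h].
  have := mem_gt x; rewrite e => /nseqP[h _].
  by rewrite -(card_loop2 hA hB) (loop_half hA hB) h.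
have all1 : all (pred1 1%N) (gtype A B).
  rewrite all_sort; apply/allP=> v /mapP[L]; rewrite mem_enum => /imsetP[x _ ->] ->.
  by have /eqP -> : #|loop A B x| == 2%N by rewrite card_loop2.
have /all_pred1P eg := all1; rewrite [LHS]eg; congr nseq.
have es : sumn (gtype A B) = size (gtype A B) by rewrite [in LHS]eg sumn_nseq mul1n.
by apply: double_inj; rewrite -hT -(sumn_gtype hA hB) es.
Qed.

Lemma sum_delta2 (V : nmodType) (I J : finType) (A : {set I}) (B : {set J}) i0 j0 (F : I -> V) :
  i0 \in A -> j0 \in B ->
  \sum_(i in A) \sum_(j in B) (if (i == i0) && (j == j0) then F i else 0) = F i0.
Proof.
move=> hi hj; rewrite (bigD1 i0) //= (bigD1 j0) //= !eqxx big1 => [|j /andP[_ /negbTE ->] //].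
by rewrite big1 ?addr0 // => i /andP[_ /negbTE ni]; apply: big1 => j _; rewrite ni.
Qed.

(** Type $1^n$ means [S = twist t]. Then [t] preserves both rows and columns, so the identity gives
    the only term. *)
Lemma theta_pairs_ones lam : is_partition lam -> theta_pairs (nseq (sumn lam) 1%N) lam = 1.
Proof.
move=> hlam; rewrite /theta_pairs.
have c1 : 1%g \in colstab (@box_col lam) by apply/colstabP=> b; rewrite perm1.
have r1 : twist 1 \in rowpair (@box_row lam).
  by apply/rowpairP; split=> [|x]; rewrite ?twist_pairing // twist1E.
have key (t : {perm box lam}) S : t \in colstab (@box_col lam) -> S \in rowpair (@box_row lam) ->
    (gtype (twist t) S == nseq (sumn lam) 1%N) = (t == 1%g) && (S == twist 1).
  move=> ht hS; have /rowpairP[pS rS] := hS.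
  rewrite (gtype_ones (card_boxb hlam)) ?twist_pairing //.
  apply/forallP/andP => [h|[/eqP -> /eqP ->] x //].
  have et : t = 1%g.
    apply/permP=> b; rewrite perm1; apply: box_inj; last exact: (colstabP _ _ ht).
    have := rS (b, true); rewrite -(eqP (h (b, true))) twistE /twist_fun /=.
    by move=> ->.
  split; apply/eqP=> //; apply/permP=> x; by rewrite -(eqP (h x)) et.
transitivity (((-1) ^+ (1%g : {perm box lam})) : rat); last by rewrite odd_perm1.
rewrite -(sum_delta2 (fun t : {perm box lam} => (-1) ^+ t) c1 r1).
apply: eq_bigr => t ht; apply: eq_bigr => S hS.
by rewrite (key t S ht hS).
Qed.

Lemma card_rows_above lam j : is_partition lam ->
  #|[set x : box lam * bool | (box_row x.1 < j)%N]| = (sumn (take j lam)).*2.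
Proof.
move=> hlam; rewrite -(card_boxes_above hlam) -muln2 -card_bool -cardsT -cardsX.
by apply: eq_card => x; rewrite !inE andbT.
Qed.

Definition part_weight (r : seq nat) : rat := (zee r)%:R * 2 ^+ size r.

Lemma match_weight0 r : (match_weight r 0)%:R = part_weight r.
Proof. by rewrite /match_weight add0n binn muln1 mulnC natrM natrX. Qed.

(* [S] and [S'] are determined by [s], [t] and [t'], and their being row-preserving is an
   invariance condition on [t'] and [t] respectively. *)
Lemma theta_pairs_bijection lam lam' (s : {ffun box lam * bool -> box lam' * bool})
    (s' : box lam' * bool -> box lam * bool) : cancel s s' -> cancel s' s ->
  \sum_(t in colstab (@box_col lam)) \sum_(S in rowpair (@box_row lam))
   \sum_(t' in colstab (@box_col lam')) \sum_(S' in rowpair (@box_row lam'))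
     (if s \in emb (twist t) S S' (twist t') then (-1) ^+ t * (-1) ^+ t' else 0) =
  (\sum_(t in colstab (@box_col lam) | col_inv (fun x => box_row (s x).1) t) (-1) ^+ t) *
  (\sum_(t' in colstab (@box_col lam') | col_inv (fun y => box_row (s' y).1) t') (-1) ^+ t') :> rat.
Proof.
move=> sK s'K.
set Q := col_inv (fun x => box_row (s x).1); set P := col_inv (fun y => box_row (s' y).1).
pose c (t : {perm box lam}) (t' : {perm box lam'}) : rat := (-1) ^+ t * (-1) ^+ t'.
transitivity (\sum_(t in colstab (@box_col lam)) \sum_(t' in colstab (@box_col lam'))
    if Q t && P t' then c t t' else 0); last first.
  rewrite big_distrlr /= [RHS]big_mkcondr /=; apply: eq_bigr => t _.
  case: (Q t) => /=; first by rewrite [RHS]big_mkcondr.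
  by rewrite big1.
apply: eq_bigr => t _; rewrite exchange_big /=; apply: eq_bigr => t' _.
transitivity (\sum_(u : unit | Q t && P t') c t t'); last first.
  by case: ifP => h; [rewrite (big_pred1 tt) // => -[] | rewrite big_pred0].
rewrite pair_big /= -big_mkcondr /=.
have rowS S S' : s \in emb (twist t) S S' (twist t') ->
    (forall x, S x = s' (twist t' (s x))) /\ (forall y, S' y = s (twist t (s' y))).
  case/embP=> _ eA eB _; split=> [x|y]; first by rewrite -eB sK.
  by rewrite eA s'K.
apply: eq_big_unique => [[S1 S1'] [S2 S2'] /andP[_ /rowS[a1 a2]] /andP[_ /rowS[b1 b2]]|[] []|
    [S S'] /andP[/andP[/rowpairP[pS rS] /rowpairP[pS' rS']] /rowS[a1 a2]]|[] /andP[/forallP Qt /forallP Pt']|] //.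
- congr (_, _); apply/permP=> x; first by rewrite a1 b1.
  by rewrite a2 b2.
- exists tt; apply/andP; split; apply/forallP=> x.
    by rewrite -{1}[x]sK -a2 rS'.
  by rewrite -{1}[x]s'K -a1 rS.
have cs y : y \in codom s by apply/codomP; exists (s' y); rewrite s'K.
have cs' x : x \in codom s' by apply/codomP; exists (s x); rewrite sK.
have [S [pS eS]] := pairing_pullback (can_inj sK) (twist_pairing t') (fun x => cs _).
have [S' [pS' eS']] := pairing_pullback (can_inj s'K) (twist_pairing t) (fun x => cs' _).
exists (S, S'); apply/andP; split; [apply/andP; split|].
- by apply/rowpairP; split=> // x; have := Pt' (s x); rewrite -eS !sK => /eqP.
- by apply/rowpairP; split=> // y; have := Qt (s' y); rewrite -eS' !s'K => /eqP.
- apply/embP; split=> [|x|x|y]; [exact: can_inj sK| |exact: eS|by rewrite cs].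
  by apply: (can_inj s'K); rewrite eS' !sK.
Qed.

(** The weight counts isomorphisms from the graph of [twist t] and [S] to that of [S'] and
    [twist t'], columns facing rows. For one bijection the sum factors; if both factors are nonzero,
    each diagram dominates the other, so they coincide. *)
Lemma theta_pairs_orth lam lam' : is_partition lam -> is_partition lam' ->
  sumn lam = sumn lam' -> lam != lam' ->
  \sum_(r <- parts (sumn lam)) theta_pairs r lam * theta_pairs r lam' * part_weight r = 0.
Proof.
move=> hlam hlam' hs ne.
under eq_bigr => r _ do rewrite -mulrA.
rewrite (sum_theta_pairs (fun r => theta_pairs r lam' * part_weight r)) //.
transitivity (\sum_(s : {ffun box lam * bool -> box lam' * bool})
  \sum_(t in colstab (@box_col lam)) \sum_(S in rowpair (@box_row lam))
   \sum_(t' in colstab (@box_col lam')) \sum_(S' in rowpair (@box_row lam'))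
     (if s \in emb (twist t) S S' (twist t') then (-1) ^+ t * (-1) ^+ t' else 0) : rat).
  rewrite [RHS]exchange_big; apply: eq_bigr => t _ /=.
  rewrite [RHS]exchange_big; apply: eq_bigr => S /rowpairP[pS _] /=.
  rewrite [RHS]exchange_big /theta_pairs mulr_suml mulr_sumr; apply: eq_bigr => t' _ /=.
  rewrite [RHS]exchange_big mulr_suml mulr_sumr; apply: eq_bigr => S' /rowpairP[pS' _] /=.
  have hX : #|{: box lam' * bool}| = (#|{: box lam * bool}| + 0.*2)%N.
    by rewrite !card_boxb // hs addn0.
  rewrite -big_mkcond sumr_const (card_emb (twist_pairing t) pS pS' (twist_pairing t') hX).
  rewrite sort_cat_ones ?gtype_partition ?twist_pairing // cats0 gtypeC.
  case: ifP => _; last by rewrite mul0r mulr0 mulr0n.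
  by rewrite -mulr_natr match_weight0 mulrA.
apply: big1 => s _; case: (boolP (injectiveb s)) => [/injectiveP inj|ninj]; last first.
  apply: big1 => t _; apply: big1 => S _; apply: big1 => t' _; apply: big1 => S' _.
  by case: ifP => // /embP[/injectiveP inj]; rewrite inj in ninj.
have [s' sK s'K] : bijective s by apply: inj_card_bij inj _; rewrite !card_boxb // hs.
rewrite (theta_pairs_bijection sK s'K); apply/eqP; apply: contraR ne.
rewrite mulf_eq0 negb_or => /andP[n1 n2].
have card_pull (X Y : finType) (f : X -> Y) (f' : Y -> X) (p : pred Y) :
    cancel f f' -> cancel f' f -> #|[set x | p (f x)]| = #|[set y | p y]|.
  move=> fK f'K; rewrite -[RHS](card_imset _ (can_inj f'K)); apply: eq_card => x; rewrite inE.
  apply/idP/imsetP => [h|[y]]; first by exists (f x); rewrite ?inE ?fK.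
  by rewrite inE => hy ->; rewrite f'K.
apply/eqP; apply: prefix_sums_inj => // j.
have d1 := alternating_col_dominates j hlam n1.
have d2 := alternating_col_dominates j hlam' n2.
apply/eqP; rewrite eqn_leq; apply/andP; split; rewrite -leq_double.
  rewrite -(card_rows_above j hlam); apply: leq_trans d2.
  by rewrite (card_pull _ _ s' s (fun x => box_row x.1 < j)%N).
rewrite -(card_rows_above j hlam'); apply: leq_trans d1.
by rewrite (card_pull _ _ s s' (fun x => box_row x.1 < j)%N).
Qed.

Theorem zonal_spec_theta_pairs theta rho lam : zonal_spec theta ->
  is_partition lam -> rho \in parts (sumn lam) -> theta rho lam = theta_pairs rho lam.
Proof.
move=> spec hlam hrho; set n := sumn lam in hrho *.
have lamP : lam \in parts n by rewrite parts_mem hlam /=.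
have inP l : l \in parts n -> is_partition l /\ sumn l = n.
  by rewrite parts_mem => /andP[pl /eqP].
apply: (@triangular_orthogonal_uniq rat _ (parts n) (power_coef n) part_weight
  (prefix_height n) size (nseq n 1%N) (parts_uniq n) (ones_parts n)
  _ (@power_coef_diag n) (@power_coef_tri n) (fun l r => theta_pairs r l) _ _ _
  (fun l r => theta r l)) => //.
- move=> r; rewrite parts_mem => /andP[/andP[_ /allP r0] _]; rewrite /part_weight.
  apply: Num.Theory.mulr_gt0; last by rewrite Num.Theory.exprn_gt0.
  rewrite Num.Theory.ltr0n /zee big_seq prodn_cond_gt0 // => i.
  by rewrite mem_undup => /r0 i0; rewrite muln_gt0 expn_gt0 i0 fact_gt0.
- move=> l m lP mP; have [pl sl] := inP l lP => nz.
  apply: dominated_height => //; apply: theta_pairs_tri => //; by rewrite ?sl.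
- move=> l l' /inP[pl sl] /inP[pl' sl'] ne.
  by rewrite /pairing_form -{1}sl theta_pairs_orth ?sl.
- by move=> l /inP[pl <-]; exact: theta_pairs_ones.
- move=> l m lP mP; rewrite -coefs_Zpoly => nz.
  by have [tri _ _] := spec n l lP; apply: dominated_height => //; exact: tri.
- move=> l l' lP lP' ne; have [_ orth _] := spec n l lP.
  have := orth l' lP'; rewrite eq_sym => /(_ ne) h; rewrite -[RHS]h.
  by apply: eq_bigr => r _; rewrite /part_weight mulrA.
(* In the squarefree coefficient only the $p_{1^n}$ term survives, and $n!$ cancels. *)
- move=> l lP; have [_ _ norm] := spec n l lP.
  move: norm; rewrite coefs_Zpoly /coefs.
  rewrite (bigD1_seq (nseq n 1%N)) ?ones_parts ?parts_uniq //= power_coef_ones ?ones_parts // eqxx.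
  rewrite big1_seq ?addr0 => [|r /andP[/negbTE nr hr]]; last by rewrite power_coef_ones // nr mulr0.
  have f0 : (n`!)%:R != 0 :> rat by rewrite Num.Theory.pnatr_eq0 -lt0n fact_gt0.
  by move/eqP; rewrite -[X in _ == X]mul1r (inj_eq (mulIf f0)) => /eqP.
Qed.
End ThetaPairs.

(** * The orbit sum *)

Local Open Scope ring_scope.

Theorem theorem3p13 (k : nat) (mu : seq nat) (S1 S2 : {perm 'I_(2 * k)})
  (start : {set 'I_(2 * k)} -> 'I_(2 * k))
  (rep : {set Po k} -> Po k)
  (theta : seq nat -> seq nat -> rat) :
  is_partition mu -> sumn mu = k ->
  pair_partition S1 -> pair_partition S2 -> loop_type S1 S2 = mu ->
  (forall L, L \in loops S1 S2 -> start L \in L) ->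
  (forall O, O \in orbitsPo S1 S2 start -> rep O \in O) ->
  zonal_spec theta ->
  forall lam : seq nat, is_partition lam ->
    Sigma2 theta mu lam =
    \sum_(O in orbitsPo S1 S2 start)
       loop_sign (rep O).1 S1 * (N1 (rep O).1 S1 S2 lam)%:R.
Proof.
move=> pmu smu h1 h2 hty hstart hrep spec lam plam.
(* At the type ['I_(2 * k)] the general notions unfold to those of the statement. *)
have hgt : gtype S1 S2 = mu by [].
(* Both sides are multiplied by the common orbit size $2^{\ell(\mu)}$, which turns the orbit sum
   into a sum over $\mathcal{P}^o$. *)
have two : (2 ^+ size mu : rat) != 0 by rewrite expf_neq0.
apply: (mulfI two); rewrite -hgt size_gtype.
rewrite -(@sum_orbits k S1 S2 start h1 h2 hstart
  (fun x => loop_sign x.1 S1 * (N1 x.1 S1 S2 lam)%:R) rep hrep); last first.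
  move=> I x /Po_setP[px _ _]; rewrite /actPo /=.
  have c1 := flipp_commS1 h1 h2 hstart I; have c2 := flipp_commS2 h1 h2 hstart I.
  by rewrite (loop_sign_conj h1 px c1) (N1_conj _ _ c1 c2).
rewrite (sum_Po h1 h2 plam hgt) hgt /Sigma2 smu -size_gtype hgt.
case: ifP => hk; last by rewrite mulr0.
have inP : (mu ++ nseq (sumn lam - k) 1%N)%SEQ \in parts (sumn lam).
  rewrite parts_mem sumn_cat sumn_nseq mul1n smu subnKC // eqxx andbT -sort_cat_ones //.
  apply/andP; split; first by apply: sort_sorted => a b; exact: leq_total.
  rewrite all_sort all_cat; apply/andP; split; first by case/andP: pmu.
  by apply/allP=> x /nseqP[->].
rewrite (zonal_spec_theta_pairs spec plam inP) /match_weight !natrM natrX.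
by rewrite !mulrA; congr (_ * _); rewrite -!mulrA; congr (_ * _); rewrite mulrC.
Qed.
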